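(* Let $K$ be a compact Hausdorff space. Then the following statements are equivalent. (i) $K$ satisfies property ( *** ). (ii) $K$ admits a category measure. (iii) $\mathrm{C}(K)^\delta$ admits a strictly positive $\sigma$-order continuous linear functional. (iv) $\mathrm{C}(K)$ admits a strictly positive $\sigma$-order continuous linear functional. (v) $\mathrm{C}(K)$ admits a strictly positive order continuous linear functional. (vi) $\mathrm{C}(K)^\delta$ admits a strictly positive order continuous linear functional.
   Context: $\mathrm{C}(K)$ is the Banach lattice of continuous real-valued functions on $K$ (pointwise order, supremum norm). $\mathrm{C}(K)^\delta$ is its Dedekind completion: the unique (up to linear lattice isometry) Dedekind complete Banach lattice containing $\mathrm{C}(K)$ as a majorizing, order dense (isometrically embedded) sublattice. (A sublattice $F$ of $E$ is order dense if for every $0<f\in E$ there is $g\in F$ with $0<g\le f$, and majorizing if every $0\le f\in E$ satisfies $f\le g$ for some $g\in F$.) Functionals: a linear functional $\varphi$ on a vector lattice $E$ is strictly positive if $\varphi(f)>0$ for all $0<f\in E$. An order bounded functional $\varphi$ on $E$ is $\sigma$-order continuous if $\inf\{|\varphi(f_n)|:n\in\mathbb{N}\}=0$ for every decreasing sequence $(f_n)$ in $E$ with infimum $0$, and order continuous if $\inf\{|\varphi(f)|:f\in D\}=0$ for every downward directed $D\subseteq E$ with infimum $0$. Category measure: let $\mathcal{N}_K$ be the collection of meagre subsets of $K$ and $\Sigma^{\mathcal{C}}_K=\{U\Delta N:U\subseteq K\text{ open},\ N\in\mathcal{N}_K\}$, the $\sigma$-algebra of sets with the property of Baire. A category measure on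 $K$ is a positive $\sigma$-additive measure $\mu:\Sigma^{\mathcal{C}}_K\to\mathbb{R}$ (so finite) such that for every $A\in\Sigma^{\mathcal{C}}_K$, $\mu(A)=0$ if and only if $A\in\mathcal{N}_K$. Kelley intersection number: for a nonempty set $X$ and a collection $\mathcal{F}$ of nonempty subsets of $X$, for $n\in\mathbb{N}$ and $\bar F=\langle F_1,\dots,F_n\rangle\in\mathcal{F}^n$ let $i(\bar F)=\max\{|J|:J\subseteq\{1,\dots,n\},\ \bigcap_{j\in J}F_j\neq\emptyset\}$, and let $k(\mathcal{F})=\inf\{i(\bar F)/n:n\in\mathbb{N},\ \bar F\in\mathcal{F}^n\}$. Property ( *** ): let $\mathcal{T}$ be the collection of nonempty open subsets of $K$. $K$ satisfies property ( *** ) if there is a partition $\{\mathcal{T}_n:n\in\mathbb{N}\}$ of $\mathcal{T}$ such that for every $n\in\mathbb{N}$: (a) $k(\mathcal{T}_n)>0$; (b) if $(U_m)$ is an increasing sequence of open sets with $\bigcup_{m}U_m\in\mathcal{T}_n$, then there is $m_0\in\mathbb{N}$ with $U_{m_0}\in\mathcal{T}_n$; (c) if $U\in\mathcal{T}_n$ and $V$ is an open set such that $U\Delta V$ is meagre, then $V\in\mathcal{T}_n$. *)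

(* Defs.v *)
From HB Require Import structures.
From mathcomp Require Import all_boot all_order all_algebra.
From mathcomp Require Import all_classical all_reals all_analysis.

Set Implicit Arguments.
Unset Strict Implicit.
Unset Printing Implicit Defensive.

Import Order.TTheory GRing.Theory Num.Theory.
Import numFieldNormedType.Exports.

Local Open Scope classical_set_scope.
Local Open Scope ring_scope.

(* The order is not taken from the [Order] hierarchy: Hierarchy Builder cannot
   join a partial order with the normed modules, as that join would have to sit
   below the already declared [numDomainType]. *)
HB.mixin Record isVectorLattice (R : realType) (E : Type)
    of GRing.Lmodule R E := {
  vle : E -> E -> Prop ;
  vjoin : E -> E -> E ;
  vmeet : E -> E -> E ;
  vle_refl : forall x, vle x x ;
  vle_anti : forall x y, vle x y -> vle y x -> x = y ;
  vle_trans : forall y x z, vle x y -> vle y z -> vle x z ;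
  vjoin_le : forall x y z, vle (vjoin x y) z <-> vle x z /\ vle y z ;
  vle_meet : forall x y z, vle z (vmeet x y) <-> vle z x /\ vle z y ;
  vle_addr : forall x y z, vle x y -> vle (x + z) (y + z) ;
  vle_scale : forall (a : R) x y, 0 <= a -> vle x y -> vle (a *: x) (a *: y) }.

#[short(type="vectorLatticeType")]
HB.structure Definition VectorLattice (R : realType) :=
  {E of GRing.Lmodule R E & isVectorLattice R E}.

Definition vlt (R : realType) (E : vectorLatticeType R) (x y : E) :=
  vle x y /\ x <> y.

Notation "x <=v y" := (vle x y) (at level 70, y at next level).
Notation "x <v y" := (vlt x y) (at level 70, y at next level).

Definition vabs (R : realType) (E : vectorLatticeType R) (x : E) : E :=
  vjoin x (- x).

(* [`|x|] is the norm of [x]; the modulus of [x] in the lattice is [vabs x]. *)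
HB.mixin Record isBanachLattice (R : realType) (E : Type)
    of VectorLattice R E & CompleteNormedModule R E := {
  le_vabs_norm : forall x y : E, vabs x <=v vabs y -> `|x| <= `|y| }.

#[short(type="banachLatticeType")]
HB.structure Definition BanachLattice (R : realType) :=
  {E of VectorLattice R E & CompleteNormedModule R E & isBanachLattice R E}.

Section VectorLatticeNotions.
Context {R : realType} {E : vectorLatticeType R}.
Implicit Types (x y f g : E) (A D F : set E) (phi : {scalar E}).

Definition upper_bound A x := forall y, A y -> y <=v x.
Definition lower_bound A x := forall y, A y -> x <=v y.
Definition is_sup A x := upper_bound A x /\ forall y, upper_bound A y -> x <=v y.
Definition is_inf A x := lower_bound A x /\ forall y, lower_bound A y -> y <=v x.

Definition order_dense F :=
  forall f, 0 <v f -> exists g, [/\ F g, 0 <v g & g <=v f].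

Definition majorizing F := forall f, 0 <=v f -> exists2 g, F g & f <=v g.

Definition down_directed D := D !=set0 /\
  forall f g, D f -> D g -> exists h, [/\ D h, h <=v f & h <=v g].

Definition strictly_positive phi := forall f, 0 <v f -> 0 < phi f.

Definition order_bounded phi :=
  forall a b, exists M : R, forall f, a <=v f -> f <=v b -> `|phi f| <= M.

Definition sigma_order_continuous phi := order_bounded phi /\
  forall f : nat -> E, (forall n, f n.+1 <=v f n) -> is_inf (range f) 0 ->
    inf [set `|phi (f n)| | n in [set: nat]] = 0.

Definition order_continuous phi := order_bounded phi /\
  forall D, down_directed D -> is_inf D 0 -> inf [set `|phi f| | f in D] = 0.

End VectorLatticeNotions.

Definition dedekind_complete (R : realType) (E : vectorLatticeType R) :=
  forall A : set E, A !=set0 -> (exists b, upper_bound A b) ->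
    exists s, is_sup A s.

Definition admits_strictly_positive_sigma_order_continuous
    (R : realType) (E : vectorLatticeType R) :=
  exists phi : {scalar E}, strictly_positive phi /\ sigma_order_continuous phi.

Definition admits_strictly_positive_order_continuous
    (R : realType) (E : vectorLatticeType R) :=
  exists phi : {scalar E}, strictly_positive phi /\ order_continuous phi.

(* C(K) is [continuousType K R] with the pointwise operations and order. *)
Section ContinuousFunctions.
Context {R : realType} {K : topologicalType}.
Local Notation CK := (continuousType K R).
Implicit Types f g h : CK.

Lemma addc_subproof f g : continuous (fun x => f x + g x : R).
Proof. by move=> x; apply: (@cvgD _ R^o); exact: cts_fun. Qed.

Lemma oppc_subproof f : continuous (fun x => - f x : R).
Proof. by move=> x; apply: (@cvgN _ R^o); exact: cts_fun. Qed.

Lemma scalec_subproof (a : R) f : continuous (fun x => a * f x : R).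
Proof. by move=> x; apply: cvgM; [exact: cvg_cst|exact: cts_fun]. Qed.

Lemma minc_subproof f g : continuous (fun x => Num.min (f x) (g x) : R).
Proof. by move=> x; apply: continuous_min; exact: cts_fun. Qed.

Lemma maxc_subproof f g : continuous (fun x => Num.max (f x) (g x) : R).
Proof. by move=> x; apply: continuous_max; exact: cts_fun. Qed.

Definition zeroc : CK := cst 0.
Definition addc f g : CK := mkcts (@addc_subproof f g).
Definition oppc f : CK := mkcts (@oppc_subproof f).
Definition scalec (a : R) f : CK := mkcts (@scalec_subproof a f).
Definition minc f g : CK := mkcts (@minc_subproof f g).
Definition maxc f g : CK := mkcts (@maxc_subproof f g).
Definition lec f g : Prop := forall x, f x <= g x.

Lemma addcA : associative addc.
Proof. by move=> f g h; apply/continuousEP => x; exact: addrA. Qed.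
Lemma addcC : commutative addc.
Proof. by move=> f g; apply/continuousEP => x; exact: addrC. Qed.
Lemma add0c : left_id zeroc addc.
Proof. by move=> f; apply/continuousEP => x; exact: add0r. Qed.
Lemma addNc : left_inverse zeroc oppc addc.
Proof. by move=> f; apply/continuousEP => x; exact: addNr. Qed.

HB.instance Definition _ := GRing.isZmodule.Build CK addcA addcC add0c addNc.

Lemma scalecA (a b : R) f : scalec a (scalec b f) = scalec (a * b) f.
Proof. by apply/continuousEP => x; exact: mulrA. Qed.
Lemma scale1c : left_id 1 scalec.
Proof. by move=> f; apply/continuousEP => x; exact: mul1r. Qed.
Lemma scalecDr : right_distributive scalec +%R.
Proof. by move=> a f g; apply/continuousEP => x; exact: mulrDr. Qed.
Lemma scalecDl f : {morph scalec^~ f : a b / a + b}.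
Proof. by move=> a b; apply/continuousEP => x; exact: mulrDl. Qed.

HB.instance Definition _ :=
  GRing.Zmodule_isLmodule.Build R CK scalecA scale1c scalecDr scalecDl.

Lemma lec_refl f : lec f f.
Proof. by move=> x. Qed.
Lemma lec_anti f g : lec f g -> lec g f -> f = g.
Proof.
by move=> fg gf; apply/continuousEP => x; apply/eqP; rewrite eq_le fg gf.
Qed.
Lemma lec_trans g f h : lec f g -> lec g h -> lec f h.
Proof. by move=> fg gh x; exact: le_trans (fg x) (gh x). Qed.
Lemma maxc_lec f g h : lec (maxc f g) h <-> lec f h /\ lec g h.
Proof.
split=> [le|[fh gh] x]; last by rewrite /maxc /mkcts /= ge_max fh gh.
by split=> x; have := le x; rewrite ge_max => /andP[].
Qed.
Lemma lec_minc f g h : lec h (minc f g) <-> lec h f /\ lec h g.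
Proof.
split=> [le|[hf hg] x]; last by rewrite /minc /mkcts /= le_min hf hg.
by split=> x; have := le x; rewrite le_min => /andP[].
Qed.
Lemma lec_addr f g h : lec f g -> lec (f + h) (g + h).
Proof. by move=> fg x; apply: lerD. Qed.
Lemma lec_scale (a : R) f g : 0 <= a -> lec f g -> lec (a *: f) (a *: g).
Proof. by move=> a0 fg x; apply: ler_wpM2l. Qed.

HB.instance Definition _ := isVectorLattice.Build R CK
  lec_refl lec_anti lec_trans maxc_lec lec_minc lec_addr lec_scale.

(* For compact [K] the supremum is finite; it is [0] when [K] is empty. *)
Definition sup_norm f : R := sup [set `|f x| | x in [set: K]].

End ContinuousFunctions.

(* [(E, J)] is a model of the Dedekind completion of C(K), [J] being the
   inclusion.  All models are isometrically lattice isomorphic over C(K). *)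
Record is_dedekind_completion (R : realType) (K : topologicalType)
    (E : banachLatticeType R)
    (J : {linear continuousType K R -> E}) : Prop := IsDedekindCompletion {
  dcompl_complete : dedekind_complete E ;
  dcompl_join : forall f g, J (vjoin f g) = vjoin (J f) (J g) ;
  dcompl_meet : forall f g, J (vmeet f g) = vmeet (J f) (J g) ;
  dcompl_isometry : forall f, `|J f| = sup_norm f ;
  dcompl_majorizing : majorizing (range J) ;
  dcompl_order_dense : order_dense (range J) }.

Section Category.
Context {K : topologicalType}.

Definition nowhere_dense (A : set K) := interior (closure A) = set0.

Definition meagre (A : set K) := exists F : nat -> set K,
  (forall n, nowhere_dense (F n)) /\ A = \bigcup_n F n.

(* [`+`] is the symmetric difference. *)
Definition baire_property (A : set K) :=
  exists U N : set K, [/\ open U, meagre N & A = U `+` N].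

(* Only the values of [mu] on sets with the Baire property matter.  The measures
   of the library live on pointed types, which would exclude an empty [K]. *)
Definition category_measure (R : realType) (mu : set K -> R) :=
  [/\ forall A, baire_property A -> 0 <= mu A,
      mu set0 = 0,
      forall A : nat -> set K, (forall n, baire_property (A n)) ->
        trivIset setT A ->
        (fun n => \sum_(0 <= i < n) mu (A i)) @ \oo --> mu (\bigcup_n A n) &
      forall A, baire_property A -> (mu A = 0 <-> meagre A)].

Definition admits_category_measure (R : realType) :=
  exists mu : set K -> R, category_measure mu.

End Category.
Arguments admits_category_measure : clear implicits.

Section Kelley.
Context {X : Type}.

Definition intersection_index (n : nat) (F : 'I_n -> set X) : nat :=
  \max_(J : {set 'I_n} | `[< \bigcap_(j in [set` J]) F j !=set0 >]) #|J|.

(* With the infimum taken in the extended reals, the empty collection has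
   intersection number [+oo]. *)
Definition kelley_number (R : realType) (F : set (set X)) : \bar R :=
  ereal_inf [set r | exists n (G : 'I_n -> set X),
    [/\ (0 < n)%N, forall i, F (G i) &
        r = ((intersection_index G)%:R / n%:R)%:E]].

End Kelley.

(* Members [T n] of the partition may be empty: when [K] is finite there are
   only finitely many open sets to distribute. *)
Definition property_star3 (R : realType) (K : topologicalType) :=
  exists T : nat -> set (set K),
    [/\ \bigcup_n T n = [set U | open U /\ U !=set0],
        trivIset setT T &
        forall n, [/\ (0 < kelley_number R (T n))%E,
          forall U : nat -> set K, (forall m, open (U m)) ->
            (forall m, U m `<=` U m.+1) -> T n (\bigcup_m U m) ->
            exists m0, T n (U m0) &
          forall U V : set K, T n U -> open V -> meagre (U `+` V) -> T n V]].

(* Main.v *)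
(* A positive category measure gives the functional [f |-> \int f], which is
   sigma-order continuous because a decreasing sequence in C(K) with infimum [0]
   converges to [0] off a meagre set.  For strictly positive functionals sigma-order
   continuity and order continuity coincide, and such a functional passes between
   C(K) and its completion because every element of the completion is both the
   supremum of the elements of C(K) below it and the infimum of those above it.
   An order continuous [phi] on C(K) yields a content [nu] on the open sets, whose
   level classes [phi 1 / (n+2) < nu U <= phi 1 / (n+1)] form the partition of
   property ( *** ): summing [phi] over functions supported in the given open sets
   bounds their intersection number from below.

   Conversely, Kelley's argument (a Hahn-Banach theorem below the essential supremum
   modulo meagre sets) turns [k(T_n) > 0] into a finitely additive content vanishing
   on meagre sets and bounded away from [0] on [T_n].  The countably additive part of
   a weighted sum of these contents is still bounded away from [0] on each [T_n],
   since by (b) and (c) an increasing sequence exhausting a member of [T_n] modulo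
   meagre sets already has a term equal to a member of [T_n] modulo a meagre set. *)

Require Import Defs.
From HB Require Import structures.
From mathcomp Require Import all_boot all_order all_algebra.
From mathcomp Require Import all_classical all_reals all_analysis.
From mathcomp Require Import ring lra.

Import Order.TTheory GRing.Theory Num.Theory.
Import numFieldNormedType.Exports.

Local Open Scope classical_set_scope.
Local Open Scope ring_scope.

Set Implicit Arguments.
Unset Strict Implicit.
Unset Printing Implicit Defensive.

(** * Meagre sets and the Baire property *)

Section BaireProperty.
Context {K : topologicalType}.
Implicit Types (A B U V N : set K).

Lemma nowhere_dense_sub A B : A `<=` B -> nowhere_dense B -> nowhere_dense A.
Proof.
move=> AB; rewrite /nowhere_dense -!subset0 => B0; apply: subset_trans B0.
exact/interiorS/closureS.
Qed.

Lemma nowhere_dense_meagre A : nowhere_dense A -> meagre A.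
Proof.
by move=> A0; exists (fun=> A); split=> //; rewrite bigcup_const//; exists 0%N.
Qed.

Lemma meagre0 : meagre (set0 : set K).
Proof. by apply: nowhere_dense_meagre; rewrite /nowhere_dense closure0 interior0. Qed.

Lemma meagre_sub A B : A `<=` B -> meagre B -> meagre A.
Proof.
move=> AB [F [F0 BF]]; exists (fun n => F n `&` A); split=> [n|].
  exact: nowhere_dense_sub (F0 n).
by rewrite -setI_bigcupl -BF setIidr.
Qed.

Lemma meagre_bigcup (A : nat -> set K) :
  (forall n, meagre (A n)) -> meagre (\bigcup_n A n).
Proof.
move=> /choice[F FA].
exists (fun k => if @unpickle (nat * nat)%type k is Some (i, j) then F i j else set0).
split=> [k|].
  case: unpickle => [[i j]|]; first exact: (FA i).1.
  by rewrite /nowhere_dense closure0 interior0.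
apply/seteqP; split=> [x [i _]|x [k _]].
  rewrite (FA i).2 => -[j _ Fx].
  by exists (pickle (i, j)) => //; rewrite pickleK.
case: unpickle => [[i j]|//] Fx; exists i => //.
by rewrite (FA i).2; exists j.
Qed.

Lemma meagreU A B : meagre A -> meagre B -> meagre (A `|` B).
Proof.
move=> mA mB; rewrite -bigcup2E; apply: meagre_bigcup => -[//|[//|n]].
exact: meagre0.
Qed.

Lemma nowhere_dense_boundary A : closed A -> nowhere_dense (A `\` interior A).
Proof.
move=> cA; rewrite /nowhere_dense -subset0.
have /closure_id <- : closed (A `\` interior A).
  by rewrite setDE; apply: closedI => //; apply/open_closedC/open_interior.
move=> x /[dup] /(@interior_subset _ _)[Ax nAx].
by move/(interiorS (@subIsetl _ A _)).
Qed.

Lemma in_setY A B x : (A `+` B) x <-> (A x /\ ~ B x) \/ (B x /\ ~ A x).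
Proof. by []. Qed.

Lemma baire_propertyP A :
  baire_property A <-> exists2 U, open U & meagre (A `+` U).
Proof.
split=> [[U [N [oU mN ->]]]|[U oU mAU]].
  exists U => //; apply: meagre_sub mN => x; rewrite !in_setY.
  by case: (pselect (U x)); case: (pselect (N x)); tauto.
exists U, (A `+` U); split=> //; apply/seteqP; split=> x; rewrite !in_setY;
  by case: (pselect (U x)); case: (pselect (A x)); tauto.
Qed.

Lemma open_baire_property U : open U -> baire_property U.
Proof.
by move=> oU; apply/baire_propertyP; exists U => //; rewrite setYK; exact: meagre0.
Qed.

Lemma meagre_baire_property A : meagre A -> baire_property A.
Proof.
move=> mA; apply/baire_propertyP; exists set0; first exact: open0.
by rewrite setY0.
Qed.

Lemma baire_property0 : baire_property (set0 : set K).
Proof. exact: open_baire_property open0. Qed.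

(** The complement of an open set is closed, and a closed set differs from its interior only by a
    nowhere dense set. *)
Lemma baire_propertyC A : baire_property A -> baire_property (~` A).
Proof.
move=> /baire_propertyP[U oU mAU]; apply/baire_propertyP.
exists (interior (~` U)); first exact: open_interior.
apply: (@meagre_sub _ ((A `+` U) `|` (~` U `\` interior (~` U)))).
  move=> x; rewrite in_setY => AUx.
  have IU : interior (~` U) x -> ~ U x by exact: interior_subset.
  suff : ((A x /\ ~ U x) \/ (U x /\ ~ A x)) \/
    (~ U x /\ ~ interior (~` U) x) by [].
  move: (interior _) AUx IU => V; rewrite /setC /mkset.
  by case: (pselect (A x)); case: (pselect (U x)); tauto.
apply: meagreU => //; apply/nowhere_dense_meagre/nowhere_dense_boundary.
exact: open_closedC.
Qed.

Lemma baire_property_bigcup (A : nat -> set K) :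
  (forall n, baire_property (A n)) -> baire_property (\bigcup_n A n).
Proof.
move=> bA; have /choice[U AU] n : exists U, open U /\ meagre (A n `+` U).
  by have /baire_propertyP[U] := bA n; exists U.
apply/baire_propertyP; exists (\bigcup_n U n).
  by apply: bigcup_open => n _; exact: (AU n).1.
apply: (@meagre_sub _ (\bigcup_n (A n `+` U n))).
  move=> x /in_setY[[[n _ Ax] nU]|[[n _ Ux] nA]]; exists n => //; apply/in_setY.
    by left; split=> // Ux; apply: nU; exists n.
  by right; split=> // Ax; apply: nA; exists n.
by apply: meagre_bigcup => n; exact: (AU n).2.
Qed.

Lemma baire_propertyU A B :
  baire_property A -> baire_property B -> baire_property (A `|` B).
Proof.
move=> bA bB; rewrite -bigcup2E; apply: baire_property_bigcup => -[//|[//|n]].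
exact: baire_property0.
Qed.

Lemma baire_propertyI A B :
  baire_property A -> baire_property B -> baire_property (A `&` B).
Proof.
move=> bA bB; rewrite -[A]setCK -[B]setCK -setCU; apply: baire_propertyC.
by apply: baire_propertyU; exact: baire_propertyC.
Qed.

Lemma meagre_setYC A B : meagre (A `+` B) -> meagre (B `+` A).
Proof. by rewrite setYC. Qed.

End BaireProperty.

(** * The Baire category theorem for compact Hausdorff spaces *)

Section CompactHausdorff.
Context {K : topologicalType}.
Hypotheses (K_compact : compact [set: K]) (K_hausdorff : hausdorff_space K).
Implicit Types U V : set K.

(** Shrink [U] through nonempty open sets [W n], the closure of [W n.+1] lying in [W n] and avoiding
    [F n]. By compactness some point lies in all the closures, hence in [U] but in no [F n]. *)
Lemma open_not_meagre U : open U -> U !=set0 -> ~ meagre U.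
Proof.
move=> oU U0 [F [Fnd UF]].
(* The condition on [V] sits under the existential so that [choice] yields a total map, which can
   then be iterated. *)
have step n V : exists W, open V /\ V !=set0 ->
    [/\ open W, W !=set0, W `<=` V & closure W `<=` V `\` closure (F n)].
  case: (pselect (open V /\ V !=set0)) => [[oV V0]|nV]; last by exists set0.
  have oVF : open (V `\` closure (F n)).
    by rewrite setDE; apply: openI => //; apply/closed_openC/closed_closure.
  have [x Vx] : V `\` closure (F n) !=set0.
    apply/set0P/eqP; rewrite setD_eq0 => VF; case: V0 => y Vy.
    suff: interior (closure (F n)) y by rewrite Fnd.
    by apply: (interiorS VF); rewrite (interior_id V).1.
  have [W nW WV] := compact_regular K_hausdorff K_compact filterT
    (open_nbhs_nbhs (conj oVF Vx) : nbhs x _).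
  exists (interior W) => _; split; first exact: open_interior.
  - by exists x.
  - by move=> y /interior_subset /(@subset_closure _ W) /WV[].
  - by apply: subset_trans (closureS _) WV; exact: interior_subset.
have /choice[g gP] n : exists h : set K -> set K, forall V, open V /\ V !=set0 ->
    [/\ open (h V), h V !=set0, h V `<=` V & closure (h V) `<=` V `\` closure (F n)].
  by have /choice[h] := step n; exists h.
pose W := fix W n := if n is m.+1 then g m (W m) else U.
have WP n : open (W n) /\ W n !=set0.
  by elim: n => [//|n /(gP n)[]].
have WS n : W n.+1 `<=` W n by have [] := gP n _ (WP n).
have Wle m n : (m <= n)%N -> W n `<=` W m.
  move=> /subnK <-; elim: (n - m)%N => [|k IH]; first exact: subset_refl.
  by rewrite addSn; exact: subset_trans (WS _) IH.
have /choice[x xW] n : exists x, W n x by have [_ [x]] := WP n; exists x.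
have [p [_ px]] : [set: K] `&` cluster (x @ \oo) !=set0.
  by apply: K_compact; exact: filterT.
have pW n : closure (W n) p.
  move=> B; apply: px; exists n => // m /= nm; exact: Wle nm _ (xW m).
have Up : U p by have [_ _ _ /(_ _ (pW 1%N))[]] := gP 0%N _ (WP 0%N).
move: Up; rewrite UF => -[n _ Fp].
have [_ _ _ /(_ _ (pW n.+1))[_]] := gP n _ (WP n).
by apply; exact: subset_closure.
Qed.

End CompactHausdorff.

(** * Functionals on vector lattices *)

(** Nonemptiness matters: the infimum of the empty set is [0] by default, while the right-hand side
    fails for it. *)
Lemma inf_norm_eq0P (R : realType) (T : Type) (A : set T) (h : T -> R) :
  A !=set0 ->
  inf [set `|h x| | x in A] = 0 <-> forall e, 0 < e -> exists2 x, A x & `|h x| < e.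
Proof.
move=> A0.
have hl : has_inf [set `|h x| | x in A].
  by split; [case: A0 => x Ax; exists `|h x|, x|exists 0 => _ [x _ <-]].
split=> [i0 e e0|he].
  by have [_ [x Ax <-]] := inf_adherent e0 hl; rewrite i0 add0r; exists x.
apply/eqP; rewrite eq_le; apply/andP; split; last first.
  by apply: lb_le_inf; [case: hl|move=> _ [x _ <-]].
rewrite leNgt; apply/negP => /he[x Ax]; apply/negP; rewrite -leNgt.
by apply: ge_inf; [case: hl|exists x].
Qed.

Lemma exists_scalar (R : realType) (E : lmodType R) (f : E -> R) :
  (forall x y, f (x + y) = f x + f y) -> (forall a x, f (a *: x) = a * f x) ->
  exists phi : {scalar E}, phi =1 f.
Proof.
move=> fD fZ.
have lin : linear_for *%R f by move=> a x y; rewrite fD fZ.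
pose m := GRing.isLinear.Build R E R *%R f lin.
by exists (HB.pack_for {scalar E} f m).
Qed.

Section VectorLattice.
Context {R : realType} {E : vectorLatticeType R}.
Implicit Types (x y z : E) (phi : {scalar E}).

Lemma vle_add2 x y z t : x <=v y -> z <=v t -> x + z <=v y + t.
Proof.
move=> xy zt; apply: (@vle_trans _ _ (y + z)); first exact: vle_addr.
by rewrite ![y + _]addrC; exact: vle_addr.
Qed.

Lemma vsub_ge0 x y : 0 <=v y - x <-> x <=v y.
Proof.
split=> [/(vle_addr _ _ x)|/(vle_addr _ _ (- x))]; first by rewrite add0r subrK.
by rewrite subrr.
Qed.

Lemma vle_opp x y : x <=v y -> - y <=v - x.
Proof. by move=> xy; apply/vsub_ge0; rewrite opprK addrC; apply/vsub_ge0. Qed.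

Lemma vle_joinl x y : x <=v vjoin x y.
Proof. by have /vjoin_le[] := vle_refl (vjoin x y). Qed.

Lemma vle_joinr x y : y <=v vjoin x y.
Proof. by have /vjoin_le[] := vle_refl (vjoin x y). Qed.

Lemma vmeet_lel x y : vmeet x y <=v x.
Proof. by have /vle_meet[] := vle_refl (vmeet x y). Qed.

Lemma vmeet_ler x y : vmeet x y <=v y.
Proof. by have /vle_meet[] := vle_refl (vmeet x y). Qed.

Lemma strictly_positive_ge0 phi x : strictly_positive phi -> 0 <=v x -> 0 <= phi x.
Proof.
move=> phi0 x0; case: (eqVneq 0 x) => [<-|/eqP x1]; first by rewrite linear0.
by apply/ltW/phi0.
Qed.

Lemma strictly_positive_le phi x y :
  strictly_positive phi -> x <=v y -> phi x <= phi y.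
Proof.
move=> phi0 /vsub_ge0 /(strictly_positive_ge0 phi0).
by rewrite linearB subr_ge0.
Qed.

Lemma strictly_positive_order_bounded phi :
  strictly_positive phi -> order_bounded phi.
Proof.

move=> phi0 a b; exists (`|phi a| + `|phi b|) => f af fb.
have pa := strictly_positive_le phi0 af; have pb := strictly_positive_le phi0 fb.
rewrite ler_norml; have := ler_norm (phi b); have := ler_norm (- phi a).
by rewrite normrN; have := normr_ge0 (phi a); have := normr_ge0 (phi b); lra.
Qed.

Lemma order_continuous_sigma phi : order_continuous phi -> sigma_order_continuous phi.
Proof.
move=> [phi_b phi_c]; split=> // f fS f0.
have fle m n : (m <= n)%N -> f n <=v f m.
  move=> /subnK <-; elim: (n - m)%N => [|k IH]; first exact: vle_refl.
  by rewrite addSn; exact: vle_trans (fS _) IH.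
rewrite -(phi_c _ _ f0); last first.
  split=> [|_ _ [m _ <-] [n _ <-]]; first by exists (f 0%N), 0%N.
  exists (f (maxn m n)); split; first by exists (maxn m n).
  - exact/fle/leq_maxl.
  - exact/fle/leq_maxr.
by congr inf; rewrite image_comp.
Qed.

(** Directedness allows each near-minimizer of [phi] to be pushed below the previous term. *)
Lemma decreasing_minimizing_sequence phi (D : set E) :
  strictly_positive phi -> down_directed D -> lower_bound D 0 ->
  exists f : nat -> E, [/\ forall n, D (f n), forall n, f n.+1 <=v f n &
    forall n, phi (f n) < inf [set phi x | x in D] + n.+1%:R^-1].
Proof.
move=> phi0 [[d0 Dd0] Ddir] D0; set a := inf _.
have hl : has_inf [set phi x | x in D].
  split; first by exists (phi d0), d0.
  by exists 0 => _ [x Dx <-]; exact: strictly_positive_ge0 (D0 _ Dx).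
have step n x : exists y, D x -> [/\ D y, y <=v x & phi y < a + n.+1%:R^-1].
  case: (pselect (D x)) => [Dx|nDx]; last by exists x.
  have n0 : 0 < n.+1%:R^-1 :> R by [].
  have [_ [z Dz <-] zn] := inf_adherent n0 hl.
  have [y [Dy yx yz]] := Ddir _ _ Dx Dz; exists y => _; split=> //.
  exact: le_lt_trans (strictly_positive_le phi0 yz) zn.
have /choice[g gP] n : exists h : E -> E, forall x, D x ->
    [/\ D (h x), h x <=v x & phi (h x) < a + n.+1%:R^-1].
  by have /choice[h] := step n; exists h.
pose W := fix W n := if n is m.+1 then g m (W m) else d0.
have DW n : D (W n) by elim: n => [//|n /(gP n)[]].
(* The shift drops [d0], on which [phi] has no prescribed bound. *)
exists (fun n => W n.+1); split=> n; first exact: DW.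
- by have [] := gP n.+1 _ (DW n.+1).
- by have [] := gP n _ (DW n).
Qed.

(* A strictly positive functional sees only countably many elements of a
   directed set: a sequence minimizing [phi] already has the infimum of the
   whole set. *)
Lemma sigma_order_continuous_order phi : strictly_positive phi ->
  sigma_order_continuous phi -> order_continuous phi.
Proof.
move=> phi0 [phi_b phi_s]; split=> // D Ddir [D0 Dinf].
have [f [Df fS fa]] := decreasing_minimizing_sequence phi0 Ddir D0.
have lb_inf x : D x -> inf [set phi x | x in D] <= phi x.
  move=> Dx; apply: ge_inf; last by exists x.
  by exists 0 => _ [y Dy <-]; exact: strictly_positive_ge0 (D0 _ Dy).
have f0 : is_inf (range f) 0.
  split=> [_ [n _ <-]|g gf]; first exact: D0 (Df n).
  (* [j] is the positive part of [g - d]. For [h] in [D] below [d] and [f n] it lies below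
     [f n - h], where [phi] is less than [1 / (n + 1)] because [phi h] is at least the infimum.
     Strict positivity then forces [j = 0]. *)
  apply: Dinf => d Dd; pose j := vjoin (g - d) 0.
  have j0 : 0 <=v j by exact: vle_joinr.
  suff j_eq0 : j = 0.
    apply/vsub_ge0; rewrite -opprB -[0]oppr0; apply: vle_opp.
    by rewrite -j_eq0; exact: vle_joinl.
  apply: contrapT => /nesym j_neq0; have := phi0 j (conj j0 j_neq0).
  apply/negP; rewrite -leNgt; apply/ler_addgt0Pl => e e0; rewrite addr0.
  have [n] := ltr_add_invr e0.
  rewrite add0r => /ltW; apply: le_trans.
  have [h [Dh hd hf]] := Ddir.2 _ _ Dd (Df n).
  apply: (@le_trans _ _ (phi (f n - h))).
    apply: strictly_positive_le => //; apply/vjoin_le; split; last exact/vsub_ge0.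
    by apply: vle_add2; [apply: gf; exists n|exact: vle_opp].
  rewrite linearB; have := fa n; have := lb_inf _ Dh.
  by move: (inf _) (phi h) (phi (f n)) (n.+1%:R^-1) => a u v r; lra.
apply/(inf_norm_eq0P _ Ddir.1) => e e0.
have fn0 : range f !=set0 by exists (f 0%N), 0%N.
have := phi_s f fS f0.
have -> : [set `|phi (f n)| | n in setT] = [set `|phi x| | x in range f].
  by rewrite image_comp.
by move/(inf_norm_eq0P _ fn0) => /(_ _ e0)[_ [n _ <-]]; exists (f n).
Qed.

End VectorLattice.

(** * The Dedekind completion of C(K) *)

Section ContinuousOnCompact.
Context {R : realType} {K : topologicalType}.
Hypothesis K_compact : compact [set: K].
Implicit Types f g : continuousType K R.

Lemma continuous_compact_bounded f : exists M, forall x, `|f x| <= M.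
Proof.
have : compact (range f).
  apply: continuous_compact => //; apply: continuous_subspaceT; exact: cts_fun.
move=> /compact_bounded[M [_ HM]]; exists (M + 1) => x.
by apply: (HM (M + 1)); [rewrite ltrDl|exists x].
Qed.

Lemma sup_norm_eq0 f : sup_norm f = 0 -> f = 0.
Proof.
move=> f0; apply/continuousEP => x; apply/eqP; rewrite -normr_le0 -f0.
apply: ub_le_sup; last by exists x.
by have [M fM] := continuous_compact_bounded f; exists M => _ [y _ <-].
Qed.

Lemma continuousType_archimedean f g h :
  0 <=v g -> (forall n, f + g *+ n <=v h) -> g = 0.
Proof.
move=> g0 fgh; apply/continuousEP => x; apply/eqP; rewrite eq_le (g0 x) andbT.
have gn n : (g *+ n) x = g x *+ n.
  by elim: n => [//|n IH]; rewrite !mulrS -IH.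
rewrite leNgt; apply/negP => gx.
have := fgh (Num.truncn ((h x - f x) / g x)).+1 x.
have := truncnS_gt ((h x - f x) / g x); move: (Num.truncn _).+1 => n.
rewrite ltr_pdivrMr// => hn; apply/negP; rewrite -ltNge.
by rewrite -ltrBlDl (lt_le_trans hn)// gn mulr_natl.
Qed.

End ContinuousOnCompact.

Section DedekindCompletion.
Context {R : realType} {K : topologicalType} {E : banachLatticeType R}.
Context {J : {linear continuousType K R -> E}}.
Hypotheses (K_compact : compact [set: K]) (J_dc : is_dedekind_completion J).
Implicit Types (f g h : continuousType K R) (y z : E).

Lemma dcompl_inj f g : J f = J g -> f = g.
Proof.
move=> fg; apply/eqP; rewrite -subr_eq0; apply/eqP/(sup_norm_eq0 K_compact).
by rewrite -(dcompl_isometry J_dc) linearB fg subrr normr0.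
Qed.

Lemma dcompl_le f g : J f <=v J g <-> f <=v g.
Proof.
split=> fg.
  suff -> : f = vmeet f g by exact: vmeet_ler.
  apply: dcompl_inj; rewrite (dcompl_meet J_dc); apply: vle_anti; last exact: vmeet_lel.
  by apply/vle_meet; split=> //; exact: vle_refl.
have {1}-> : f = vmeet f g.
  apply: vle_anti; last exact: vmeet_lel.
  by apply/vle_meet; split=> //; exact: vle_refl.
by rewrite (dcompl_meet J_dc); exact: vmeet_ler.
Qed.

Lemma dcompl_lt0 f : 0 <v J f <-> 0 <v f.
Proof.
split=> -[f0 f_neq0]; split.
- by apply/dcompl_le; rewrite linear0.
- by move=> f_eq0; apply: f_neq0; rewrite -f_eq0 linear0.
- by rewrite -(linear0 J); apply/dcompl_le.
- by move=> f_eq0; apply/f_neq0/dcompl_inj; rewrite linear0.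
Qed.

Lemma dcompl_upper y : exists g, y <=v J g.
Proof.
have [_ [g _ <-] yg] := dcompl_majorizing J_dc (vle_joinr y 0).
by exists g; exact: vle_trans (vle_joinl _ _) yg.
Qed.

Lemma dcompl_lower y : exists f, J f <=v y.
Proof.
have [g yg] := dcompl_upper (- y); exists (- g).
by rewrite linearN -[y]opprK; exact: vle_opp.
Qed.

(** Every [y] is the supremum of the elements of C(K) below it. Otherwise order density puts some
    [0 < J g] below [y - m]; adding [g] to an [f] below [y] stays below [y], so all [f + g *+ n] lie
    under one [h], against the Archimedean property of C(K). *)
Lemma dcompl_sup y z : (forall f, J f <=v y -> J f <=v z) -> y <=v z.
Proof.
move=> yz; pose m := vmeet y z.
have m0 : 0 <=v y - m by apply/vsub_ge0; exact: vmeet_lel.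
case: (pselect (0 = y - m)) => [/esym/eqP|m_neq0].
  by rewrite subr_eq0 => /eqP ->; exact: vmeet_ler.
have [_ [[g _ <-] g0 gm]] := dcompl_order_dense J_dc (conj m0 m_neq0).
have [f fy] := dcompl_lower y; have [h yh] := dcompl_upper y.
have fgy n : J (f + g *+ n) <=v y.
  elim: n => [|n IH]; first by rewrite mulr0n addr0.
  rewrite mulrS addrCA linearD -[y](subrK m); apply: vle_add2 => //.
  by apply/vle_meet; split=> //; exact: yz.
have g_eq0 : g = 0.
  apply: (@continuousType_archimedean _ _ f g h).
    by have /dcompl_lt0[] := g0.
  by move=> n; apply/dcompl_le; exact: vle_trans (fgy n) yh.
by case: g0; rewrite g_eq0 linear0.
Qed.

Lemma dcompl_inf y z : (forall g, y <=v J g -> z <=v J g) -> z <=v y.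
Proof.
move=> yz; rewrite -[z]opprK -[y]opprK; apply: vle_opp; apply: dcompl_sup => f fy.
rewrite -[J f]opprK; apply: vle_opp; rewrite -linearN; apply: yz.
by rewrite linearN -[y]opprK; exact: vle_opp.
Qed.

Section Extension.
Variable phi : {scalar continuousType K R}.
Hypotheses (phi_pos : strictly_positive phi) (phi_oc : order_continuous phi).

(** This is the lower extension of [phi]. It is linear because order continuity lets elements of
    C(K) squeeze [y] from both sides with arbitrarily close values of [phi]. *)
Definition dcompl_extension y : R := sup [set phi f | f in [set f | J f <=v y]].

Lemma dcompl_extension_lower y f : J f <=v y -> phi f <= dcompl_extension y.
Proof.
move=> fy; apply: ub_le_sup; last by exists f.
have [g yg] := dcompl_upper y; exists (phi g) => _ [h hy <-].
by apply: strictly_positive_le => //; apply/dcompl_le; exact: vle_trans hy yg.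
Qed.

Lemma dcompl_extension_upper y g : y <=v J g -> dcompl_extension y <= phi g.
Proof.
move=> yg; apply: ge_sup.
  by have [f fy] := dcompl_lower y; exists (phi f), f.
move=> _ [f fy <-].
by apply: strictly_positive_le => //; apply/dcompl_le; exact: vle_trans fy yg.
Qed.

(** The gaps [g - f] between upper and lower brackets of [y] are directed downwards. A lower bound
    [h] of them satisfies [y <= y - J h], as [y] is both a supremum and an infimum of elements of
    C(K); so their infimum is [0] and order continuity applies. *)
Lemma dcompl_approx y e : 0 < e ->
  exists f g, [/\ J f <=v y, y <=v J g & phi g - phi f < e].
Proof.
pose D := [set h | exists f g, [/\ J f <=v y, y <=v J g & h = g - f]].
have D0 : D !=set0.
  have [f fy] := dcompl_lower y; have [g yg] := dcompl_upper y.
  by exists (g - f), f, g.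
have Ddir : down_directed D.
  split=> // _ _ [f1 [g1 [f1y yg1 ->]]] [f2 [g2 [f2y yg2 ->]]].
  exists (vmeet g1 g2 - vjoin f1 f2); split.
  - exists (vjoin f1 f2), (vmeet g1 g2); split=> //.
      by rewrite (dcompl_join J_dc); apply/vjoin_le.
    by rewrite (dcompl_meet J_dc); apply/vle_meet.
  - by apply: vle_add2; [exact: vmeet_lel|exact/vle_opp/vle_joinl].
  - by apply: vle_add2; [exact: vmeet_ler|exact/vle_opp/vle_joinr].
have Dinf : is_inf D 0.
  split=> [_ [f [g [fy yg ->]]]|h hD].
    by apply/vsub_ge0/dcompl_le; exact: vle_trans fy yg.
  apply/dcompl_le; rewrite linear0.
  suff yJh : y <=v y - J h.
    apply/vsub_ge0; rewrite sub0r.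
    by move/(vle_addr _ _ (- y)): yJh; rewrite subrr addrAC subrr add0r.
  apply: dcompl_sup => f fy; apply/vsub_ge0; rewrite addrAC; apply/vsub_ge0.
  rewrite -[J h](addrK (J f)); apply: vle_addr; apply: dcompl_inf => g yg.
  rewrite -linearD; apply/dcompl_le; rewrite -[g](subrK f); apply: vle_addr.
  by apply: hD; exists f, g.
move=> e0; have [_ /(_ _ Ddir Dinf)/(inf_norm_eq0P _ D0)/(_ _ e0)] := phi_oc.
move=> [_ [f [g [fy yg ->]]]]; rewrite linearB => /(le_lt_trans (ler_norm _)) gfe.
by exists f, g.
Qed.

(** Linearity of the extension is checked through this criterion, by combining brackets of the
    arguments. *)
Lemma dcompl_extension_unique y r :
  (forall e, 0 < e -> exists f g, [/\ J f <=v y, y <=v J g, phi f <= r,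
     r <= phi g & phi g - phi f < e]) -> r = dcompl_extension y.
Proof.
move=> rP; apply/eqP; rewrite -subr_eq0 -normr_le0; apply/ler_addgt0Pl => e e0.
have [f [g [/dcompl_extension_lower fy /dcompl_extension_upper yg fr rg gf]]] := rP e e0.
rewrite addr0 ler_norml.
by move: (dcompl_extension y) (phi f) (phi g) fy yg fr rg gf => s u v; lra.
Qed.

Lemma dcompl_extensionD y z :
  dcompl_extension (y + z) = dcompl_extension y + dcompl_extension z.
Proof.
apply/esym/dcompl_extension_unique => e e0.
have e2 : 0 < e / 2 by lra.
have [f1 [g1 [fy yg gf1]]] := dcompl_approx y e2.
have [f2 [g2 [fz zg gf2]]] := dcompl_approx z e2.
exists (f1 + f2), (g1 + g2); rewrite !(linearD J) !(linearD phi).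
have := dcompl_extension_lower fy; have := dcompl_extension_upper yg.
have := dcompl_extension_lower fz; have := dcompl_extension_upper zg.
move: (dcompl_extension y) (dcompl_extension z) => s t.
move: (phi f1) (phi f2) (phi g1) (phi g2) gf1 gf2 => u v w x uw vx xt tv ws su.
by split; try exact: vle_add2; lra.
Qed.

Lemma dcompl_extensionN y : dcompl_extension (- y) = - dcompl_extension y.
Proof.
apply/esym/dcompl_extension_unique => e e0.
have [f [g [fy yg gf]]] := dcompl_approx y e0.
exists (- g), (- f); rewrite !(linearN J) !(linearN phi).
have := dcompl_extension_lower fy; have := dcompl_extension_upper yg.
move: (dcompl_extension y) (phi f) (phi g) gf => r u v uv rv ur.
by split; try exact: vle_opp; lra.
Qed.

Lemma dcompl_extensionZ a y : dcompl_extension (a *: y) = a * dcompl_extension y.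
Proof.
wlog a0 : a / 0 <= a.
  move=> wl; case: (leP 0 a) => [/wl//|a0].
  by rewrite -[a]opprK scaleNr dcompl_extensionN wl ?mulNr// oppr_ge0 ltW.
apply/esym/dcompl_extension_unique => e e0.
(* Dividing by [a + 1] rather than [a] covers [a = 0]. *)
have ea : 0 < e / (a + 1) by rewrite divr_gt0// ltr_wpDl.
have [f [g [fy yg gf]]] := dcompl_approx y ea.
have phiZ h : phi (a *: h) = a * phi h by rewrite linearZ.
have JZ h : J (a *: h) = a *: J h by rewrite linearZ.
exists (a *: f), (a *: g); rewrite !phiZ !JZ; split.
- exact: vle_scale.
- exact: vle_scale.
- by rewrite ler_wpM2l// dcompl_extension_lower.
- by rewrite ler_wpM2l// dcompl_extension_upper.
- rewrite -mulrBr; move: gf; rewrite ltr_pdivlMr ?ltr_wpDl//; apply: le_lt_trans.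
  rewrite mulrC; apply: ler_wpM2l; last by rewrite lerDl.
  rewrite subr_ge0.
  by apply: strictly_positive_le => //; apply/dcompl_le; exact: vle_trans fy yg.
Qed.

Lemma order_continuous_extension :
  admits_strictly_positive_order_continuous E.
Proof.
have [psi psiE] := exists_scalar dcompl_extensionD dcompl_extensionZ.
have psi_pos : strictly_positive psi.
  move=> y y0; rewrite psiE.
  have [_ [[f _ <-] /dcompl_lt0 f0 fy]] := dcompl_order_dense J_dc y0.
  exact: lt_le_trans (phi_pos f0) (dcompl_extension_lower fy).
exists psi; split=> //; split; first exact: strictly_positive_order_bounded.
move=> D Ddir [D0 Dinf]; apply/(inf_norm_eq0P _ Ddir.1) => e e0.
(* [C] transfers [D] to C(K): it is again directed with infimum [0], and a small value of [phi] on
   [C] bounds [psi] at an element of [D] below. *)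
pose C := [set f | exists2 d, D d & d <=v J f].
have C0 : C !=set0.
  by have [d Dd] := Ddir.1; have [f df] := dcompl_upper d; exists f, d.
have Cdir : down_directed C.
  split=> // f1 f2 [d1 Dd1 df1] [d2 Dd2 df2].
  exists (vmeet f1 f2); split; [|exact: vmeet_lel|exact: vmeet_ler].
  have [d [Dd dd1 dd2]] := Ddir.2 _ _ Dd1 Dd2; exists d => //.
  rewrite (dcompl_meet J_dc); apply/vle_meet.
  by split; [exact: vle_trans dd1 df1|exact: vle_trans dd2 df2].
have Cinf : is_inf C 0.
  split=> [f [d Dd df]|h hC].
    by apply/dcompl_le; rewrite linear0; exact: vle_trans (D0 _ Dd) df.
  apply/dcompl_le; rewrite linear0; apply: Dinf => d Dd.
  by apply: dcompl_inf => g dg; apply/dcompl_le/hC; exists d.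
have [_ /(_ _ Cdir Cinf)/(inf_norm_eq0P _ C0)/(_ _ e0)[f [d Dd df] fe]] := phi_oc.
exists d => //; rewrite ger0_norm; last exact: strictly_positive_ge0 (D0 _ Dd).
by rewrite psiE; apply: le_lt_trans fe; apply: le_trans (ler_norm _);
  exact: dcompl_extension_upper.
Qed.

End Extension.

(** Infima equal to [0] survive the passage from C(K) to [E]: a lower bound [y] in [E] is the
    supremum of the [J f] below it, and each such [f] is at most [0]. *)
Lemma order_continuous_restriction :
  admits_strictly_positive_order_continuous E ->
  admits_strictly_positive_order_continuous (continuousType K R).
Proof.
move=> [psi [psi_pos [_ psi_oc]]].
have [phi phiE] : exists phi : {scalar continuousType K R}, phi =1 psi \o J.
  by apply: exists_scalar => [f g|a f] /=; rewrite ?linearD ?linearZ.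
have phi_pos : strictly_positive phi.
  by move=> f f0; rewrite phiE; apply/psi_pos/dcompl_lt0.
exists phi; split=> //; split; first exact: strictly_positive_order_bounded.
move=> D Ddir [D0 Dinf].
rewrite -(psi_oc (J @` D)); first by rewrite image_comp; congr inf;
  apply: eq_imagel => f _ /=; rewrite phiE.
- split=> [|_ _ [f1 Df1 <-] [f2 Df2 <-]].
    by have [f Df] := Ddir.1; exists (J f), f.
  have [f [Df ff1 ff2]] := Ddir.2 _ _ Df1 Df2.
  by exists (J f); split; [exists f|apply/dcompl_le|apply/dcompl_le].
- split=> [_ [f Df <-]|y yD]; first by rewrite -(linear0 J); apply/dcompl_le/D0.
  apply: dcompl_sup => f fy; rewrite -(linear0 J); apply/dcompl_le/Dinf => g Dg.
  by apply/dcompl_le; apply: vle_trans fy _; apply: yD; exists g.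
Qed.

End DedekindCompletion.

(** * From order continuous functionals to intersection numbers *)

Section OrderContinuousFunctional.
Context {R : realType} {K : topologicalType}.
Hypotheses (K_compact : compact [set: K]) (K_hausdorff : hausdorff_space K).
Local Notation CK := (continuousType K R).
Implicit Types (f g h : CK) (U V : set K).

Lemma urysohn_bump U x : open U -> U x ->
  exists b : CK, [/\ forall y, 0 <= b y <= 1, b x = 1 & forall y, ~ U y -> b y = 0].
Proof.
move=> oU Ux; have Kn := compact_normal K_hausdorff K_compact.
have cx : closed [set x] by apply/accessible_closed_set1/hausdorff_accessible.
have [|f [cf f0 f1 f01]] := urysohn_ext_itv Kn (open_closedC oU) cx _ (@ltr01 R).
  by apply/seteqP; split=> [y [nUy yx]//|//]; apply: nUy; rewrite yx.
exists (mkcts cf); split=> [y||y Uy].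
- by have := f01 (f y) (ex_intro2 _ _ y I erefl); rewrite /= in_itv.
- by apply: f1; exists x.
- by apply: f0; exists y.
Qed.

(** A point of [U] outside the closure of [V] would have an open neighbourhood inside the meagre
    difference. *)
Lemma open_subset_closure U V : open U -> open V -> meagre (U `+` V) ->
  U `<=` closure V.
Proof.
move=> oU oV mUV x Ux B; rewrite nbhsE => -[W [oW Wx] WB].
apply: contrapT => VB0; apply: (open_not_meagre K_compact K_hausdorff (openI oW oU)).
  by exists x.
apply: meagre_sub mUV => y [Wy Uy]; left; split=> // Vy.
by apply: VB0; exists y; split=> //; exact: WB.
Qed.

Variable phi : {scalar CK}.
Hypotheses (phi_pos : strictly_positive phi) (phi_oc : order_continuous phi).

Definition supported_in U f := forall x, ~ U x -> f x = 0.

(** The differences [f - g], with [g] below [f] and supported in some [V m], are directed. Their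
    infimum is [0]: if a lower bound [h] were positive at a point of [U], it would be positive at
    some [y] in some [V m], where cutting [f] off by a bump gives [g y = f y]. *)
Lemma order_continuous_approx f U (V : nat -> set K) a :
  (forall m, open (V m)) -> (forall m, V m `<=` V m.+1) ->
  U `<=` closure (\bigcup_m V m) -> 0 <=v f -> supported_in U f -> a < phi f ->
  exists m g, [/\ 0 <=v g, g <=v f, supported_in (V m) g & a < phi g].
Proof.
move=> oV VS UV f0 fU af.
have Vle m n : (m <= n)%N -> V m `<=` V n.
  move=> /subnK <-; elim: (n - m)%N => [|k IH]; first exact: subset_refl.
  by rewrite addSn; exact: subset_trans IH (VS _).
pose D := [set h | exists m g, [/\ 0 <=v g, g <=v f, supported_in (V m) g & h = f - g]].
have D0 : D f.
  by exists 0%N, 0; split=> //; rewrite subr0.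
have Ddir : down_directed D.
  split=> [|_ _ [m1 [g1 [g10 g1f g1V ->]]] [m2 [g2 [g20 g2f g2V ->]]]].
    by exists f.
  exists (f - vjoin g1 g2); split.
  - exists (maxn m1 m2), (vjoin g1 g2); split=> //.
    + exact: vle_trans g10 (vle_joinl _ _).
    + exact/vjoin_le.
    + move=> x nVx; rewrite /vjoin/= /maxc /mkcts/=.
      rewrite g1V ?g2V ?maxxx// => Vx; apply: nVx.
        by apply: Vle Vx; exact: leq_maxr.
      by apply: Vle Vx; exact: leq_maxl.
  - by rewrite ![f - _]addrC; apply/vle_addr/vle_opp/vle_joinl.
  - by rewrite ![f - _]addrC; apply/vle_addr/vle_opp/vle_joinr.
have Dinf : is_inf D 0.
  split=> [_ [m [g [_ gf _ ->]]]|h hD]; first exact/vsub_ge0.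
  move=> x; change (h x <= 0); rewrite leNgt; apply/negP => hx.
  have Ux : U x.
    apply: contrapT => /fU fx; have := hD _ D0 x.
    by rewrite fx leNgt hx.
  have hpos : nbhs x [set y | 0 < h y].
    apply: open_nbhs_nbhs; split=> //; apply: (@open_comp _ _ h [set r | 0 < r]) => //.
      by move=> y _; exact: cts_fun.
  have [y [[m _ Vy] hy]] := UV x Ux _ hpos.
  have [b [b01 by1 b0]] := urysohn_bump (oV m) Vy.
  pose g := vmeet f (f y *: b).
  have gy : g y = f y.
    by rewrite /g /vmeet/= /minc /mkcts/= /GRing.scale/= by1 mulr1 minxx.
  have Dg : D (f - g).
    exists m, g; split=> //; last first.
    - move=> z nVz; rewrite /g /vmeet/= /minc /mkcts/= /GRing.scale/= b0// mulr0.
      by rewrite min_r//; exact: f0.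
    - exact: vmeet_lel.
    - apply/vle_meet; split=> // z; rewrite /GRing.scale/= mulr_ge0//; first exact: f0.
      by have /andP[] := b01 z.
  have := hD _ Dg y; change (h y <= f y - g y -> False).
  by rewrite gy subrr leNgt hy.
have [_ /(_ _ Ddir Dinf)/(inf_norm_eq0P _ Ddir.1)] := phi_oc.
move=> /(_ (phi f - a))[|_ [m [g [g0 gf gV ->]]]]; first by rewrite subr_gt0.
rewrite linearB => /(le_lt_trans (ler_norm _)) ga.
by exists m, g; split=> //; move: ga; rewrite ltrD2l ltrN2.
Qed.

(* The value at the indicator function of [U] of the order continuous extension
   of [phi]. *)
Definition open_content U : R :=
  sup [set phi f | f in [set f | [/\ 0 <=v f, f <=v (cst 1 : CK) & supported_in U f]]].

Lemma open_content_ge U f : 0 <=v f -> f <=v (cst 1 : CK) -> supported_in U f ->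
  phi f <= open_content U.
Proof.
move=> f0 f1 fU; apply: ub_le_sup; last by exists f.
by exists (phi (cst 1 : CK)) => _ [g [_ g1 _] <-]; exact: strictly_positive_le.
Qed.

Lemma lt_open_content U a : 0 <= a -> a < open_content U ->
  exists f, [/\ 0 <=v f, f <=v (cst 1 : CK), supported_in U f & a < phi f].
Proof.
move=> a0 /sup_gt[|_ [f [f0 f1 fU] <-] af]; last by exists f.
exists (phi 0), 0 => //; split=> // x; exact: ler01.
Qed.

Lemma open_content_le U a :
  (forall f, 0 <=v f -> f <=v (cst 1 : CK) -> supported_in U f -> phi f <= a) ->
  open_content U <= a.
Proof.
move=> aP; apply: ge_sup; last by move=> _ [f [f0 f1 fU] <-]; exact: aP.
exists (phi 0), 0 => //; split=> // x; exact: ler01.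
Qed.

Lemma open_content_total U : open_content U <= phi (cst 1 : CK).
Proof. by apply: open_content_le => f _ f1 _; exact: strictly_positive_le. Qed.

Lemma open_contentS U V : U `<=` V -> open_content U <= open_content V.
Proof.
move=> UV; apply: open_content_le => f f0 f1 fU; apply: open_content_ge => //.
by move=> x nVx; apply: fU => /UV.
Qed.

Lemma open_content_gt0 U : open U -> U !=set0 -> 0 < open_content U.
Proof.
move=> oU [x Ux]; have [b [b01 bx b0]] := urysohn_bump oU Ux.
apply: (@lt_le_trans _ _ (phi b)).
  apply: phi_pos; split=> [y|b_eq0]; first by have /andP[] := b01 y.
  by have := @ltr01 R; rewrite -bx -b_eq0 ltxx.
apply: open_content_ge => // y; first by have /andP[] := b01 y.
by have /andP[] := b01 y.
Qed.

(** Asking only that [U] lie in the closure of the union lets this serve both clause (b) and, with a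
    constant sequence, clause (c). The function found has positive [phi], so its support set is
    nonempty. *)
Lemma lt_open_content_bigcup U (V : nat -> set K) a :
  (forall m, open (V m)) -> (forall m, V m `<=` V m.+1) ->
  U `<=` closure (\bigcup_m V m) -> 0 <= a -> a < open_content U ->
  exists2 m, a < open_content (V m) & V m !=set0.
Proof.
move=> oV VS UV a0 /(lt_open_content a0)[f [f0 f1 fU af]].
have [m [g [g0 gf gV ag]]] := order_continuous_approx oV VS UV f0 fU af.
exists m.
  by apply: lt_le_trans ag _; apply: open_content_ge => //; exact: vle_trans gf f1.
apply: contrapT => /set0P/negP; rewrite negbK => /eqP Vm0; move: ag.
suff -> : g = 0 by rewrite linear0 ltNge a0.
by apply/continuousEP => x; apply: gV; rewrite Vm0.
Qed.

Lemma open_content_meagre U V : open U -> open V -> meagre (U `+` V) ->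
  open_content U <= open_content V.
Proof.
move=> oU oV mUV; rewrite leNgt; apply/negP => VU.
have V0 : 0 <= open_content V.
  rewrite -(linear0 phi); apply: open_content_ge => // x; exact: ler01.
have [|m] := @lt_open_content_bigcup U (fun=> V) _ (fun=> oV)
    (fun=> @subset_refl _ V) _ V0 VU.
  by rewrite bigcup_const//; exact: open_subset_closure.
by rewrite ltxx.
Qed.

Definition content_class n : set (set K) := [set U | [/\ open U, U !=set0 &
  phi (cst 1 : CK) / n.+2%:R < open_content U <= phi (cst 1 : CK) / n.+1%:R]].

Lemma card_le_intersection_index N (G : 'I_N -> set K) x :
  (#|finset (fun i => `[< G i x >])| <= intersection_index G)%N.
Proof.
rewrite /intersection_index; apply: (@leq_bigmax_cond _ _ (fun J : {set 'I_N} => #|J|)).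
by apply/asboolP; exists x => i /=; rewrite inE => /asboolP.
Qed.

(** Choose [f i] supported in [G i] with [phi (f i)] above [phi 1 / (n + 2)]. At any point at most
    [intersection_index G] of them are nonzero, so their sum is at most that multiple of [1];
    applying [phi] gives the bound [1 / (n + 2)]. *)
Lemma kelley_number_content_class n : (0 < kelley_number R (content_class n))%E.
Proof.
apply: (@lt_le_trans _ _ (n.+2%:R^-1)%:E); first by rewrite lte_fin.
apply: le_ereal_inf_tmp => _ [N [G [N0 GT ->]]]; rewrite lee_fin.
(* Positivity comes from a member of the class; it fails for empty [K], where the class is empty. *)
have phi1 : 0 < phi (cst 1 : CK).
  have [oG G0 _] := GT (Ordinal N0).
  exact: lt_le_trans (open_content_gt0 oG G0) (open_content_total _).
have /choice[f fP] i : exists f, [/\ 0 <=v f, f <=v (cst 1 : CK), supported_in (G i) f &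
    phi (cst 1 : CK) / n.+2%:R < phi f].
  have [_ _ /andP[Gi _]] := GT i; apply: lt_open_content => //.
  by rewrite divr_ge0// ltW.
have sum_le : \sum_(i < N) f i <=v (intersection_index G)%:R *: (cst 1 : CK).
  move=> x.
  have -> : (\sum_(i < N) f i) x = \sum_(i < N) f i x.
    by elim/big_ind2: _ => // ? ? ? ? <- <-.
  change (\sum_(i < N) f i x <= (intersection_index G)%:R * 1); rewrite mulr1.
  apply: le_trans (_ : #|finset (fun i => `[< G i x >])|%:R <= _).
    rewrite -sum1_card natr_sum [X in _ <= X]big_mkcond/=; apply: ler_sum => i _.
    rewrite inE; case: asboolP => Gix; have [_ f1 fG _] := fP i; first exact: f1.
    by rewrite fG.
  by rewrite ler_nat card_le_intersection_index.
have := strictly_positive_le phi_pos sum_le; rewrite linear_sum linearZ/=.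
have : N%:R * (phi (cst 1 : CK) / n.+2%:R) <= \sum_(i < N) phi (f i).
  rewrite mulr_natl -[X in _ *+ X]card_ord -sumr_const; apply: ler_sum => i _.
  by have [_ _ _ /ltW] := fP i.
move=> /le_trans/[apply]; rewrite mulrCA mulrC ler_pM2r// => iN.
by rewrite ler_pdivlMr ?ltr0n// mulrC.
Qed.

Lemma property_star3_functional : property_star3 R K.
Proof.
exists content_class; split=> [||n].
- apply/seteqP; split=> [U [n _ []//]|U [oU U0]].
  have cU := open_content_gt0 oU U0; have c1 := open_content_total U.
  (* The class index is [n] exactly when the integer part of [r] is [n + 1]. *)
  pose r := phi (cst 1 : CK) / open_content U.
  have r1 : 1 <= r by rewrite ler_pdivlMr// mul1r.
  have /andP[] := truncn_itv (le_trans ler01 r1).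
  have : (0 < Num.truncn r)%N by rewrite truncn_gt0.
  case: (Num.truncn r) => // n _ nr rn; exists n => //; split=> //.
  by rewrite ltr_pdivrMr// ler_pdivlMr// mulrC -ltr_pdivrMr// rn mulrC -ler_pdivlMr.
- apply/trivIsetP => i j _ _; rewrite neq_lt => ij; apply/seteqP; split=> // U [].
  wlog {ij} ij : i j / (i < j)%N.
    by move=> wl Ti Tj; case/orP: ij => ij; [exact: wl ij Ti Tj|exact: wl ij Tj Ti].
  move=> [_ _ /andP[iU _]] [_ _ /andP[_ Uj]].
  have := lt_le_trans iU Uj; apply/negP; rewrite -leNgt ler_wpM2l//.
    by apply: strictly_positive_ge0 => // x; exact: ler01.
  by rewrite lef_pV2 ?posrE ?ltr0n// ler_nat.
split; first exact: kelley_number_content_class.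
- move=> U oU US [oUU _ /andP[nU Un]].
  have a0 : 0 <= phi (cst 1 : CK) / n.+2%:R.
    by rewrite divr_ge0//; apply: strictly_positive_ge0 => // x; exact: ler01.
  have [m mU Um] := lt_open_content_bigcup oU US (@subset_closure _ _) a0 nU.
  exists m; split=> //; rewrite mU (le_trans _ Un)//.
  by apply: open_contentS; exact: bigcup_sup.
- move=> U V [oU U0 UT] oV mUV.
  have UV : open_content U = open_content V.
    apply/eqP; rewrite eq_le !open_content_meagre//; exact: meagre_setYC.
  split=> //; last by rewrite -UV.
  apply: contrapT => /set0P/negP; rewrite negbK => /eqP V0.
  by apply: (open_not_meagre K_compact K_hausdorff oU U0); rewrite V0 setY0 in mUV.
Qed.

End OrderContinuousFunctional.

(** * Integration against a category measure *)

Section CategoryIntegral.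
Context {R : realType} {K : topologicalType} (x0 : K).
Hypotheses (K_compact : compact [set: K]) (K_hausdorff : hausdorff_space K).
Local Notation CK := (continuousType K R).
Context {mu : set K -> R}.
Hypothesis mu_cat : category_measure mu.

(* The measurable types of the library are pointed, hence the base point. *)
Definition baire_type (_ : K) : Type := K.
Local Notation BK := (baire_type x0).

HB.instance Definition _ := Choice.copy BK K.
HB.instance Definition _ := isPointed.Build BK x0.
HB.instance Definition _ := isMeasurable.Build default_measure_display BK
  baire_property0 (@baire_propertyC K) (@baire_property_bigcup K).

(* The norm makes the function nonnegative also on sets without the Baire
   property, about which [category_measure] says nothing. *)
Definition category_emeasure (A : set BK) : \bar R := `|mu A|%:E.

Lemma category_emeasureE (A : set BK) :
  baire_property (A : set K) -> category_emeasure A = (mu A)%:E.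
Proof.
by case: mu_cat => mu_ge0 _ _ _ bA; rewrite /category_emeasure ger0_norm// mu_ge0.
Qed.

Let category_emeasure0 : category_emeasure set0 = 0%E.
Proof. by case: mu_cat => _ m0 _ _; rewrite /category_emeasure m0 normr0. Qed.

Let category_emeasure_ge0 A : (0 <= category_emeasure A)%E.
Proof. by rewrite lee_fin. Qed.

Let category_emeasure_sigma_additive : semi_sigma_additive category_emeasure.
Proof.
move=> F mF tF mUF.
rewrite category_emeasureE//.
have [_ _ /(_ F mF tF) muF _] := mu_cat.
have -> : (fun n => \sum_(0 <= i < n) category_emeasure (F i))%E =
    EFin \o (fun n => \sum_(0 <= i < n) mu (F i)).
  apply/funext => n /=; rewrite -sumEFin; apply: eq_bigr => i _.
  exact: (category_emeasureE (mF i)).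
by apply: cvg_comp; [exact: muF|exact: cvg_id].
Qed.

HB.instance Definition _ := isMeasure.Build _ BK R category_emeasure
  category_emeasure0 category_emeasure_ge0 category_emeasure_sigma_additive.

Let category_emeasure_finite : fin_num_fun category_emeasure.
Proof. by []. Qed.

HB.instance Definition _ := Measure_isFinite.Build _ BK R category_emeasure
  category_emeasure_finite.

Local Notation m := (category_emeasure : {finite_measure set BK -> \bar R}).

Lemma continuous_measurable (f : CK) : measurable_fun [set: BK] (f : BK -> R).
Proof.
apply: (measurability _ (measurable_realfun.RGenOInfty.measurableE R)) => _ [_ [r ->] <-].
rewrite setTI; apply: open_baire_property.
by apply: open_comp; [move=> x _; exact: cts_fun|exact: interval_open].
Qed.

Lemma continuous_integrable (f : CK) : m.-integrable [set: BK] (EFin \o (f : BK -> R)).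
Proof.
apply: measurable_bounded_integrable => //; first by rewrite ltry.
  exact: continuous_measurable.
have [M fM] := continuous_compact_bounded K_compact f.
by exists M; split=> [|r Mr x _]; [exact: num_real|exact: le_trans (fM x) (ltW Mr)].
Qed.

Lemma exists_integral_functional :
  exists phi : {scalar CK}, forall f, phi f = Rintegral m [set: BK] f.
Proof.
apply: exists_scalar => [f g|a f].
  by rewrite -RintegralD//; exact: continuous_integrable.
by rewrite -RintegralZl//; exact: continuous_integrable.
Qed.

(** [f] dominates [f x / 2] times the indicator of a nonempty open set, which is not meagre and so
    has positive measure. *)
Lemma integral_strictly_positive (phi : {scalar CK}) :
  (forall f, phi f = Rintegral m [set: BK] f) -> strictly_positive phi.
Proof.
move=> phiE f [f0 f_neq0]; have [x fx] : exists x, 0 < f x.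
  apply: contrapT => f_le0; apply: f_neq0; apply/continuousEP => x; apply/eqP.
  rewrite eq_le (f0 x); rewrite leNgt; apply/negP => fx; apply: f_le0.
  by exists x.
pose U : set K := [set y | f x / 2 < f y].
have oU : open U.
  apply: (@open_comp _ _ f [set r | f x / 2 < r]); last exact: open_gt.
  by move=> y _; exact: cts_fun.
have Ux : U x by rewrite /U/= ltr_pdivrMr// mulr_natr mulr2n ltrDl.
have bU := open_baire_property oU.
have mU : measurable (U : set BK) by [].
have muU : 0 < mu U.
  have [mu_ge0 _ _ mu_eq0] := mu_cat.
  rewrite lt_neqAle mu_ge0// andbT; apply/eqP => /esym/(mu_eq0 _ bU).
  by apply: (open_not_meagre K_compact K_hausdorff oU); exists x.
rewrite phiE; apply: lt_le_trans (_ : f x / 2 * mu U <= _).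
  by rewrite mulr_gt0// divr_gt0.
have -> : f x / 2 * mu U = Rintegral m [set: BK] (fun y => f x / 2 * \1_(U : set BK) y).
  rewrite RintegralZl//; last exact: integrable_indic.
  rewrite /Rintegral integral_indic// setIT -[mu U]/(fine (mu U)%:E).
  by rewrite -category_emeasureE.
apply: le_Rintegral => //.
- have -> : EFin \o (fun y => f x / 2 * \1_(U : set BK) y) =
      (fun y => (f x / 2)%:E * (\1_(U : set BK) y)%:E)%E.
    by apply/funext => y /=; rewrite EFinM.
  by apply: integrableZl => //; exact: integrable_indic.
- exact: continuous_integrable.
- move=> y _; rewrite indicE; case: (boolP (y \in (U : set BK))); rewrite ?mulr1 ?mulr0.
    by rewrite inE => /ltW.
  by move=> _; exact: f0.
Qed.

(** The set is closed, and an interior point would carry a bump of height [e] below every [f n],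
    contradicting the infimum [0]. *)
Lemma nowhere_dense_pointwise_inf (f : nat -> CK) e : 0 < e ->
  (forall n, 0 <=v f n) -> is_inf (range f) 0 ->
  nowhere_dense (\bigcap_n [set x | e <= f n x]).
Proof.
move=> e0 f0 [_ f_inf].
have cF : closed (\bigcap_n [set x | e <= f n x]).
  apply: closed_bigI => n _; apply: (@closed_comp _ _ (f n) [set r | e <= r]).
    by move=> x _; exact: cts_fun.
  exact: closed_ge.
rewrite /nowhere_dense -(closure_id _).1// -subset0 => x Fx.
have [b [b01 bx b0]] := urysohn_bump (R := R) K_compact K_hausdorff (open_interior _) Fx.
have : e *: b <=v 0.
  apply: f_inf => _ [n _ <-] y; change (e * b y <= f n y).
  have [/interior_subset Fy|nFy] := pselect ((\bigcap_n [set x | e <= f n x])^° y).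
    apply: le_trans (Fy n I); rewrite -[leRHS]mulr1 ler_wpM2l ?(ltW e0)//.
    by have /andP[] := b01 y.
  by rewrite b0// mulr0; exact: f0.
move=> /(_ x); change (e * b x <= 0 -> False); rewrite bx mulr1.
by rewrite leNgt e0.
Qed.

Lemma integral_sigma_order_continuous (phi : {scalar CK}) :
  (forall f, phi f = Rintegral m [set: BK] f) -> sigma_order_continuous phi.
Proof.
move=> phiE; have phi_pos := integral_strictly_positive phiE.
split=> [|f fS f_inf]; first exact: strictly_positive_order_bounded.
have f0 n : 0 <=v f n by case: f_inf => + _; apply; exists n.
have fle n : f n <=v f 0%N.
  by elim: n => [|n IH]; [exact: vle_refl|exact: vle_trans (fS n) IH].
(* Off [N] the decreasing values [f n x] tend to [0], and [N] is meagre, hence null; dominated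
   convergence with bound [f 0] follows. *)
pose N := \bigcup_k \bigcap_n [set x : K | k.+1%:R^-1 <= f n x].
have mN : meagre N.
  apply: meagre_bigcup => k; apply: nowhere_dense_meagre.
  exact: nowhere_dense_pointwise_inf.
have f_cvg : {ae m, forall x : BK, setT x ->
    (fun n => (f n x)%:E) @ \oo --> (cst 0%E : BK -> \bar R) x}.
  exists N; split.
  - exact: meagre_baire_property.
  - have bN := meagre_baire_property mN.
    have [_ _ _ /(_ _ bN)[_ /(_ mN) muN]] := mu_cat.
    by rewrite -[LHS]/(category_emeasure N) category_emeasureE// muN.
  - move=> x; apply: contra_notP => Nx _; apply/fine_cvgP; split; first exact: nearW.
    apply/cvgrPdist_lt => e e0; have [k] := ltr_add_invr e0; rewrite add0r => ke.
    have [n fn] : exists n, f n x < k.+1%:R^-1.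
      apply: contrapT => fk; apply: Nx; exists k => // n _ /=.
      by rewrite leNgt; apply/negP => fn; apply: fk; exists n.
    exists n => // p /= np; rewrite sub0r normrN ger0_norm; last exact: f0.
    apply: le_lt_trans (lt_trans fn ke).
    rewrite -(subnK np); elim: (p - n)%N => [//|q IH].
    by rewrite addSn; exact: le_trans (fS _ x) IH.
have cvg_int : (\int[m]_(x in [set: BK]) (f n x)%:E)%E @[n --> \oo] --> 0%E.
  have [|_ _] := @dominated_convergence _ BK R m setT measurableT
    (fun n x => (f n x)%:E) (cst 0%E) (fun x => (f 0%N x)%:E)
    (fun n => measurable_int m (continuous_integrable (f n)))
    (measurable_cst _) f_cvg (continuous_integrable (f 0%N)) _.
    by apply: aeW => x n _; rewrite lee_fin ger0_norm; [exact: fle|exact: f0].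
  by rewrite integral_cst// mul0e; apply.
have phi_cvg : phi (f n) @[n --> \oo] --> 0.
  by under eq_fun do rewrite phiE; exact: fine_cvg cvg_int.
have nat0 : [set: nat] !=set0 by exists 0%N.
apply/(inf_norm_eq0P _ nat0) => e e0.
have /cvgrPdist_lt/(_ _ e0)[n _ /(_ n (leqnn n))] := phi_cvg.
by rewrite sub0r normrN => phin; exists n.
Qed.

Lemma sigma_order_continuous_category :
  admits_strictly_positive_sigma_order_continuous (continuousType K R).
Proof.
have [phi phiE] := exists_integral_functional; exists phi; split.
  exact: integral_strictly_positive.
exact: integral_sigma_order_continuous.
Qed.

End CategoryIntegral.

Lemma category_measure_functional (R : realType) (K : topologicalType) :
  compact [set: K] -> hausdorff_space K -> admits_category_measure K R ->
  admits_strictly_positive_sigma_order_continuous (continuousType K R).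
Proof.
move=> K_compact K_hausdorff [mu mu_cat].
(* The integral lives on a pointed type. For empty [K] the zero functional is vacuously strictly
   positive. *)
have [[x0 _]|K0] := pselect ([set: K] !=set0).
  exact: (@sigma_order_continuous_category R K x0 K_compact K_hausdorff mu mu_cat).
have [phi phiE] : exists phi : {scalar continuousType K R}, phi =1 fun=> 0.
  by apply: exists_scalar => [f g|a f]; rewrite ?addr0 ?mulr0.
have phi_pos : strictly_positive phi.
  move=> f [_]; case; apply/continuousEP => x.
  by exfalso; apply: K0; exists x.
exists phi; split=> //; split; first exact: strictly_positive_order_bounded.
move=> f _ _; have nat0 : [set: nat] !=set0 by exists 0%N.
by apply/(inf_norm_eq0P _ nat0) => e e0; exists 0%N => //; rewrite phiE normr0.
Qed.

(** * From intersection numbers to contents *)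

(* Homogeneity over the naturals is enough because the content obtained from the
   minorant only has to be additive.  All inequalities are restricted to the
   subgroup [D], outside of which an essential supremum is a junk value. *)
Section AdditiveHahnBanach.
Context {R : realType} {V : zmodType} (D : set V).
Hypotheses (D0 : D 0) (DD : forall x y, D x -> D y -> D (x + y))
  (DN : forall x, D x -> D (- x)).
Implicit Types (p q : V -> R) (x y : V).

(** The third clause is one half of homogeneity; the other half follows from the first two. *)
Definition nat_sublinear p :=
  [/\ p 0 <= 0, forall x y, D x -> D y -> p (x + y) <= p x + p y &
      forall x n, D x -> p x *+ n <= p (x *+ n)].

Lemma subgroup_mulrn x n : D x -> D (x *+ n).
Proof. by move=> Dx; elim: n => [//|n IH]; rewrite mulrS; exact: DD. Qed.

Lemma nat_sublinear_mulrn p x n : nat_sublinear p -> D x -> p (x *+ n) = p x *+ n.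
Proof.
move=> [p0 pD pM] Dx; apply/eqP; rewrite eq_le pM// andbT.
elim: n => [//|n IH]; rewrite !mulrS; apply: le_trans (pD _ _ _ _) _ => //.
  exact: subgroup_mulrn.
by rewrite lerD2l.
Qed.

(** This gives the lower bounds that keep infima of families of functionals below [q] finite. *)
Lemma nat_sublinear_opp p x : nat_sublinear p -> D x -> - p (- x) <= p x.
Proof.
move=> [p0 pD pM] Dx; rewrite lerNl -subr_ge0 opprK addrC.
(* The case [n = 0] of the third clause reads [0 <= p 0]. *)
have := pM _ 0%N Dx; rewrite !mulr0n => /le_trans; apply.
by rewrite -(subrr x); apply: pD => //; exact: DN.
Qed.

Lemma le_inf_image (T : Type) (A : set T) (h : T -> R) t :
  A !=set0 -> (forall a, A a -> t <= h a) -> t <= inf [set h a | a in A].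
Proof.
move=> [a Aa] tA; apply: lb_le_inf; first by exists (h a), a.
by move=> _ [b Ab <-]; exact: tA.
Qed.

Lemma inf_image_le (T : Type) (A : set T) (h : T -> R) t a :
  (forall a, A a -> t <= h a) -> A a -> inf [set h a | a in A] <= h a.
Proof.
by move=> tA Aa; apply: ge_inf; [exists t => _ [b Ab <-]; exact: tA|exists a].
Qed.

(** This supplies the chain bounds for Zorn's lemma. Of two members of the chain, the smaller is
    subadditive and bounds the infimum at [x + y]. *)
Lemma nat_sublinear_inf_chain q (A : set (V -> R)) : A !=set0 ->
  (forall p, A p -> nat_sublinear p /\ forall x, D x -> p x <= q x) ->
  (forall p p', A p -> A p' -> (forall x, D x -> p x <= p' x) \/
    (forall x, D x -> p' x <= p x)) ->
  nat_sublinear (fun x => inf [set p x | p in A]).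
Proof.
move=> [p1 Ap1] AP Atot.
have lb x p : D x -> A p -> - q (- x) <= p x.
  move=> Dx /AP[pl pq]; apply: le_trans (nat_sublinear_opp pl Dx).
  by rewrite lerN2 pq//; exact: DN.
have infle x p : D x -> A p -> inf [set p x | p in A] <= p x.
  by move=> Dx Ap; apply: (inf_image_le (h := fun p => p x)) Ap => p' Ap'; exact: lb.
split=> [|x y Dx Dy|x n Dx].
- by apply: le_trans (infle _ _ D0 Ap1) _; have [[]] := AP _ Ap1.
- rewrite -lerBlDr; apply: (le_inf_image (h := fun p => p x)); first by exists p1.
  move=> p Ap; rewrite lerBlDr -lerBlDl.
  apply: (le_inf_image (h := fun p => p y)); first by exists p1.
  move=> p' Ap'; rewrite lerBlDl.
  have [pp'|p'p] := Atot _ _ Ap Ap'.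
    apply: le_trans (infle _ _ (DD Dx Dy) Ap) _.
    have [[_ pD _] _] := AP _ Ap; apply: le_trans (pD _ _ Dx Dy) _.
    by rewrite lerD2l pp'.
  apply: le_trans (infle _ _ (DD Dx Dy) Ap') _.
  have [[_ pD _] _] := AP _ Ap'; apply: le_trans (pD _ _ Dx Dy) _.
  by rewrite lerD2r p'p.
- apply: (le_inf_image (h := fun p => p (x *+ n))) => [|p Ap]; first by exists p1.
  have [[_ _ pM] _] := AP _ Ap; apply: le_trans (pM _ _ Dx).
  by rewrite lerMn2r infle ?orbT.
Qed.

(** The auxiliary functional of the Hahn-Banach proof, with natural multiples of [y]. It is
    sublinear and below [p], so a minimal [p] equals it on [D], and the term [n = 1] yields
    [p x + p y <= p (x + y)]. *)
Definition sublinear_shift p y x : R :=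
  inf [set p (x + y *+ n) - p y *+ n | n in [set: nat]].

Lemma sublinear_shift_le p x y n : nat_sublinear p -> D x -> D y ->
  sublinear_shift p y x <= p (x + y *+ n) - p y *+ n.
Proof.
move=> pl Dx Dy; have [p0 pD pM] := pl.
pose h n := p (x + y *+ n) - p y *+ n.
apply: (inf_image_le (h := h) (t := - p (- x))) => // k _.
rewrite lerBrDr addrC lerBlDr; apply: le_trans (pM _ k Dy) _.
have Dyk := subgroup_mulrn k Dy.
by rewrite -{1}(addKr x (y *+ k)) addrC pD//; [exact: DD|exact: DN].
Qed.

Lemma sublinear_shift_sublinear p y : D y -> nat_sublinear p ->
  nat_sublinear (sublinear_shift p y).
Proof.
move=> Dy pl; have [p0 pD pM] := pl; have nat0 : [set: nat] !=set0 by exists 0%N.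
split=> [|x z Dx Dz|x k Dx].
- by apply: le_trans (sublinear_shift_le 0 pl D0 Dy) _; rewrite !mulr0n subr0 addr0.
- rewrite -lerBlDr; apply: le_inf_image => // n _.
  rewrite lerBlDr -lerBlDl; apply: le_inf_image => // n' _; rewrite lerBlDl.
  apply: le_trans (sublinear_shift_le (n + n') pl (DD Dx Dz) Dy) _.
  have -> : x + z + y *+ (n + n') = (x + y *+ n) + (z + y *+ n').
    by rewrite mulrnDr addrACA.
  have := pD _ _ (DD Dx (subgroup_mulrn n Dy)) (DD Dz (subgroup_mulrn n' Dy)).
  rewrite [p y *+ (n + n')]mulrnDr; move: (p _) (p _) (p _) (p y *+ n) (p y *+ n').
  by move=> *; lra.
- apply: le_inf_image => // n _; case: k => [|k].
    by rewrite !mulr0n add0r subr_ge0 pM.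
  (* Multiplying by [k + 1] produces [n (k + 1)] copies of [y]; subadditivity removes the surplus
     [n k]. *)
  have := nat_sublinear_mulrn k.+1 pl (DD Dx (subgroup_mulrn n Dy)).
  rewrite mulrnDl.
  have -> : x *+ k.+1 + y *+ n *+ k.+1 = (x *+ k.+1 + y *+ n) + y *+ n *+ k.
    by rewrite (mulrS (y *+ n)) addrA.
  have Dyn := subgroup_mulrn n Dy.
  have := pD _ _ (DD (subgroup_mulrn k.+1 Dx) Dyn) (subgroup_mulrn k Dyn).
  rewrite !(nat_sublinear_mulrn _ pl)//.
  have : sublinear_shift p y x *+ k.+1 <= (p (x + y *+ n) - p y *+ n) *+ k.+1.
    by rewrite lerMn2r sublinear_shift_le ?orbT.
  rewrite mulrnBl (mulrS (p y *+ n)).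
  by move: (p _) (p _) (p y *+ n) (p y *+ n *+ k) (_ *+ k.+1) (_ *+ k.+1) => *; lra.
Qed.

Lemma additive_minorant q : nat_sublinear q -> exists L : V -> R,
  (forall x y, D x -> D y -> L (x + y) = L x + L y) /\ (forall x, D x -> L x <= q x).
Proof.
move=> ql.
pose S := {p : V -> R | nat_sublinear p /\ forall x, D x -> p x <= q x}.
(* The order is reversed, so that Zorn's lemma provides a minimal functional. *)
pose le_S (p p' : S) := `[< forall x, D x -> sval p' x <= sval p x >].
have q_in : nat_sublinear q /\ forall x, D x -> q x <= q x by [].
have [||A Atot|[p [pl pq]] p_min] := @ZL_preorder S (exist _ q q_in) le_S.
- by move=> p; apply/asboolP.
- move=> p1 p2 p3 /asboolP h12 /asboolP h23; apply/asboolP => x Dx.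
  exact: le_trans (h23 _ Dx) (h12 _ Dx).
- have [[p1 Ap1]|A0] := pselect (A !=set0); last first.
    by exists (exist _ q q_in) => p Ap; case: A0; exists p.
  pose B := [set sval p | p in A].
  have B0 : B !=set0 by exists (sval p1), p1.
  have BP p : B p -> nat_sublinear p /\ forall x, D x -> p x <= q x.
    by move=> [p' _ <-]; exact: svalP p'.
  have Btot p p' : B p -> B p' -> (forall x, D x -> p x <= p' x) \/
      (forall x, D x -> p' x <= p x).
    move=> [s As <-] [s' As' <-].
    by have [/asboolP|/asboolP] := Atot _ _ As As'; [right|left].
  have Bl := nat_sublinear_inf_chain B0 BP Btot.
  have Ble x p : D x -> B p -> inf [set p x | p in B] <= p x.
    move=> Dx Bp; apply: (inf_image_le (h := fun p => p x) (t := - q (- x))) Bp.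
    move=> p' /BP[pl' pq']; apply: le_trans (nat_sublinear_opp pl' Dx).
    by rewrite lerN2 pq'//; exact: DN.
  have Bq : nat_sublinear (fun x => inf [set p x | p in B]) /\
      forall x, D x -> inf [set p x | p in B] <= q x.
    split=> // x Dx; have Bp1 : B (sval p1) by exists p1.
    by apply: le_trans (Ble _ _ Dx Bp1) _; apply: (BP _ Bp1).2.
  pose b : S := exist _ (fun x => inf [set p x | p in B]) Bq.
  exists b => p Ap; apply/asboolP => x Dx /=.
  by apply: Ble => //; exists p.
exists p; split=> // x y Dx Dy.
have shl := sublinear_shift_sublinear Dy pl.
have shp z : D z -> sublinear_shift p y z <= p z.
  move=> Dz; apply: le_trans (sublinear_shift_le 0 pl Dz Dy) _.
  by rewrite !mulr0n subr0 addr0.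
have sh_in : nat_sublinear (sublinear_shift p y) /\
    forall z, D z -> sublinear_shift p y z <= q z.
  by split=> // z Dz; exact: le_trans (shp _ Dz) (pq _ Dz).
pose s : S := exist _ (sublinear_shift p y) sh_in.
have /asboolP/(_ x Dx)/= := p_min s (asboolT shp).
move=> /le_trans/(_ (sublinear_shift_le 1 pl Dx Dy)); rewrite !mulr1n => pxy.
have [_ pD _] := pl; apply/eqP; rewrite eq_le pD//=.
by rewrite -lerBrDr.
Qed.

(** Apply the previous result to the sublinear [r], which is below [q] and at most [0] on [- C]:
    hence [L (- c) <= 0]. Nonnegativity of [q] on [C] keeps [r] finite. *)
Lemma additive_minorant_cone q (C : set V) : nat_sublinear q ->
  C `<=` D -> C 0 -> (forall x y, C x -> C y -> C (x + y)) ->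
  (forall x, C x -> 0 <= q x) -> exists L : V -> R,
  [/\ forall x y, D x -> D y -> L (x + y) = L x + L y,
      forall x, D x -> L x <= q x & forall x, C x -> 0 <= L x].
Proof.
move=> ql CD C0 CDD Cq; have [q0 qD qM] := ql.
pose A := [set a : nat * V | C a.2].
have A0 : A !=set0 by exists (0%N, 0).
pose h x (a : nat * V) := q (x *+ a.1.+1 + a.2) / a.1.+1%:R.
pose r x := inf [set h x a | a in A].
have rlb x a : D x -> A a -> - q (- x) <= h x a.
  case: a => n c Dx Cc; rewrite /h/= ler_pdivlMr// mulNr lerNl mulr_natr.
  rewrite -nat_sublinear_mulrn//; last exact: DN.
  have Dc := CD _ Cc; have Dn := subgroup_mulrn n.+1 Dx.
  have := qD _ _ (DD Dn Dc) (subgroup_mulrn n.+1 (DN Dx)).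
  rewrite mulNrn addrAC subrr add0r; have := Cq _ Cc.
  by move: (q _) (q _) (q _) => *; lra.
have rle x a : D x -> A a -> r x <= h x a.
  by move=> Dx; apply: inf_image_le => b; exact: rlb.
have rl : nat_sublinear r.
  split=> [|x y Dx Dy|x k Dx].
  - apply: le_trans (rle _ (0%N, 0) D0 C0) _.
    by rewrite /h/= mulr1n addr0 divr1.
  - rewrite -lerBlDr; apply: le_inf_image => // -[n c] Cc.
    rewrite lerBlDr -lerBlDl; apply: le_inf_image => // -[m d] Cd.
    rewrite lerBlDl.
    pose N := (n.+1 * m.+1).-1.
    have NE : N.+1 = (n.+1 * m.+1)%N by rewrite prednK.
    have Cmul z k : C z -> C (z *+ k).
      by move=> Cz; elim: k => [//|k IH]; rewrite mulrS; exact: CDD.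
    have CA : A (N, c *+ m.+1 + d *+ n.+1) by apply: CDD; exact: Cmul.
    apply: le_trans (rle _ _ (DD Dx Dy) CA) _.
    rewrite /h/= NE.
    have -> : (x + y) *+ (n.+1 * m.+1) + (c *+ m.+1 + d *+ n.+1) =
        (x *+ n.+1 + c) *+ m.+1 + (y *+ m.+1 + d) *+ n.+1.
      rewrite !mulrnDl mulrnA -[y *+ m.+1 *+ n.+1]mulrnA [(m.+1 * n.+1)%N]mulnC.
      by rewrite addrACA.
    have Dxc : D (x *+ n.+1 + c) by apply: DD; [exact: subgroup_mulrn|exact: CD].
    have Dyd : D (y *+ m.+1 + d) by apply: DD; [exact: subgroup_mulrn|exact: CD].
    rewrite ler_pdivrMr// natrM.
    apply: le_trans (qD _ _ (subgroup_mulrn _ Dxc) (subgroup_mulrn _ Dyd)) _.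
    rewrite !nat_sublinear_mulrn//.
    rewrite -[q _ *+ m.+1]mulr_natr -[q _ *+ n.+1]mulr_natr.
    have n0 : n.+1%:R != 0 :> R by rewrite pnatr_eq0.
    have m0 : m.+1%:R != 0 :> R by rewrite pnatr_eq0.
    move: (n.+1%:R) (m.+1%:R) (q _) (q _) n0 m0 => u v a b u0 v0.
    by have -> : (b / u + a / v) * (u * v) = b * v + a * u by field; rewrite u0 v0.
  - apply: le_inf_image => // -[n c] Cc; case: k => [|k].
      rewrite /h/= !mulr0n mul0rn add0r; apply: divr_ge0 => //; exact: Cq.
    rewrite /h/= -mulrnA ler_pdivlMr//.
    pose N := (k.+1 * n.+1).-1.
    have NE : N.+1 = (k.+1 * n.+1)%N by rewrite prednK.
    have := rle x (N, c) Dx Cc; rewrite /h/= NE ler_pdivlMr// natrM.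
    by rewrite -[r x *+ _]mulr_natr mulrA.
have [L [LD Lr]] := additive_minorant rl; exists L; split=> // [x Dx|c Cc].
- apply: le_trans (Lr _ Dx) _; apply: le_trans (rle _ (0%N, 0) Dx C0) _.
  by rewrite /h/= mulr1n addr0 divr1.
- have Dc := CD _ Cc; have DNc := DN Dc.
  have L0 : L 0 = 0.
    have := LD _ _ D0 D0; rewrite addr0 => /eqP.
    by rewrite -subr_eq0 opprD addNKr oppr_eq0 => /eqP.
  have := LD _ _ Dc DNc; rewrite subrr L0.
  have : L (- c) <= 0.
    apply: le_trans (Lr _ DNc) _; apply: le_trans (rle _ (0%N, c) DNc Cc) _.
    by rewrite /h/= mulr1n addNr divr1.
  by lra.
Qed.

End AdditiveHahnBanach.

(** * The essential supremum modulo meagre sets *)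

Section EssentialSupremum.
Context {R : realType} {K : topologicalType}.
Hypothesis K_not_meagre : ~ meagre [set: K].
Implicit Types (f g : K -> R).

Definition bounded_by_const f := exists M, forall x, `|f x| <= M.

Lemma bounded_by_const0 : bounded_by_const 0.
Proof. by exists 0 => x; rewrite normr0. Qed.

Lemma bounded_by_constD f g :
  bounded_by_const f -> bounded_by_const g -> bounded_by_const (f + g).
Proof.
move=> [M fM] [N gN]; exists (M + N) => x.
by apply: le_trans (ler_normD _ _) _; exact: lerD.
Qed.

Lemma bounded_by_constN f : bounded_by_const f -> bounded_by_const (- f).
Proof. by move=> [M fM]; exists M => x; rewrite normrN. Qed.

Definition category_bound f t := meagre [set x | t < f x].

Definition category_sup f : R := inf [set t | category_bound f t].

Lemma category_bound_ge f t b : (forall x, b <= f x) -> category_bound f t -> b <= t.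
Proof.
move=> fb ft; rewrite leNgt; apply/negP => tb; apply: K_not_meagre.
by apply: meagre_sub ft => x _; exact: lt_le_trans (fb x).
Qed.

Lemma category_bound_le f b : (forall x, f x <= b) -> category_bound f b.
Proof.
move=> fb; rewrite /category_bound (_ : [set x | b < f x] = set0); first exact: meagre0.
by apply/seteqP; split=> // x; rewrite /= ltNge fb.
Qed.

Lemma category_sup_le f t : bounded_by_const f -> category_bound f t ->
  category_sup f <= t.
Proof.
move=> [M fM] ft; apply: ge_inf => //; exists (- M) => s; apply: category_bound_ge.
by move=> x; have := fM x; rewrite ler_norml => /andP[].
Qed.

Lemma category_sup_ge f b : bounded_by_const f ->
  (forall t, category_bound f t -> b <= t) -> b <= category_sup f.
Proof.
move=> [M fM] fb; apply: lb_le_inf => //; exists M.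
by apply: category_bound_le => x; exact: le_trans (ler_norm _) (fM x).
Qed.

Lemma category_sup_sublinear : nat_sublinear bounded_by_const category_sup.
Proof.
split=> [|f g bf bg|f n bf].
- by apply: category_sup_le bounded_by_const0 _; exact: category_bound_le.
- rewrite -lerBlDr; apply: category_sup_ge => // s fs; rewrite lerBlDr -lerBlDl.
  apply: category_sup_ge => // t gt; rewrite lerBlDl.
  apply: category_sup_le; first exact: bounded_by_constD.
  apply: meagre_sub (meagreU fs gt) => x /= st; apply: contrapT.
  move=> /not_orP[/negP fx /negP gx]; move: st fx gx.
  by rewrite !ltNge !negbK; change (f x + g x)%R with ((f + g) x) => /negP; 
     move=> + a b; apply; exact: lerD.
- apply: category_sup_ge.
    by apply: subgroup_mulrn bf => *; [exact: bounded_by_const0|exact: bounded_by_constD].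
  case: n => [|n] t ft.
    by rewrite mulr0n; apply: category_bound_ge ft => x; rewrite mulr0n.
  rewrite -mulr_natr -ler_pdivlMr//; apply: category_sup_le => //.
  apply: meagre_sub ft => x /=; rewrite ltr_pdivrMr// mulr_natr.
  by rewrite natmulfctE.
Qed.

End EssentialSupremum.

(** * Kelley's argument: contents from intersection numbers *)

Section FinitelyAdditive.
Context {R : realType} {K : topologicalType}.
Implicit Types (m : set K -> R) (A B : set K) (F : set (set K)).

Definition category_content m := [/\ forall A, 0 <= m A, m [set: K] <= 1,
  forall A, meagre A -> m A = 0 &
  forall A B, A `&` B = set0 -> m (A `|` B) = m A + m B].

Lemma open_ord_bigcap n (G : 'I_n -> set K) (J : {set 'I_n}) :
  (forall i, open (G i)) -> open (\bigcap_(j in [set` J]) G j).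
Proof.
move=> oG; have -> : [set` J] = [set` enum J].
  by apply/seteqP; split=> i /=; rewrite mem_enum.
by rewrite bigcap_seq; elim/big_ind: _ => //; [exact: openT|exact: openI].
Qed.

(** The point [x] makes the empty index set admissible, its intersection being the whole space, so
    the maximum is attained. *)
Lemma intersection_index_witness n (G : 'I_n -> set K) (x : K) :
  exists2 J : {set 'I_n}, \bigcap_(j in [set` J]) G j !=set0 &
    intersection_index G = #|J|.
Proof.
pose P (J : {set 'I_n}) := `[< \bigcap_(j in [set` J]) G j !=set0 >].
have P0 : P finset.set0 by apply/asboolP; exists x => i /=; rewrite inE.
rewrite /intersection_index (bigop.bigmax_eq_arg finset.set0)//.
by case: arg_maxnP => // J /asboolP PJ _; exists J.
Qed.

Hypotheses (K_baire : forall U : set K, open U -> U !=set0 -> ~ meagre U).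

(** An optimal [J] gives a nonempty open intersection, which is not meagre. On it the sum is at
    least [#|J| - e * size s], nonnegative by the choice of [e], so no negative [t] bounds the sum
    modulo meagre sets. *)
Lemma kelley_number_category_sup (x : K) F e (s : seq (set K)) :
  (forall A, F A -> open A) -> (e%:E <= kelley_number R F)%E ->
  (forall A, A \in s -> F A) ->
  0 <= category_sup (fun x => \sum_(A <- s) (\1_A x - e)).
Proof.
move=> oF eF sF.
have K_nm : ~ meagre [set: K] by apply: K_baire; [exact: openT|exists x].
apply: category_sup_ge.
  elim: s {sF} => [|A s [M HM]].
    by exists 0 => y; rewrite big_nil normr0.
  exists (1 + `|e| + M) => y; rewrite big_cons.
  apply: le_trans (ler_normD _ _) _; apply: lerD => //.
  apply: le_trans (ler_normB _ _) _; rewrite lerD2r indicE.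
  by case: (_ \in _); rewrite ?normr1 ?normr0.
move=> t; have [s0|s_gt0] := posnP (size s).
  rewrite (size0nil s0); apply: category_bound_ge => // y.
  by rewrite big_nil.
rewrite /category_bound => bt; rewrite leNgt; apply/negP => t0.
pose G (i : 'I_(size s)) := tnth (in_tuple s) i.
have FG i : F (G i) by apply: sF; exact: mem_tnth.
have [J J0 iJ] := intersection_index_witness G x.
apply: (K_baire (open_ord_bigcap J (fun i => oF _ (FG i))) J0).
apply: meagre_sub bt => y Jy; apply: lt_le_trans t0 _.
rewrite big_tnth sumrB subr_ge0 sumr_const card_ord -mulr_natr.
apply: (@le_trans _ _ #|J|%:R).
  rewrite -ler_pdivlMr ?ltr0n// -lee_fin -iJ; apply: le_trans eF _.
  by apply: ereal_inf_lbound; exists (size s), G.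
rewrite -sum1_card natr_sum big_mkcond/=; apply: ler_sum => i _.
case: ifPn => [iJ'|_]; last by rewrite indicE.
by rewrite indicE mem_set//; exact: Jy.
Qed.

(** The content is [A |-> L \1_A], where [L] is below the essential supremum and nonnegative on the
    cone of sums of [\1_A - e]. Nonnegativity at [\1_A - e] gives [L \1_A >= L e], and
    [L (- e) <= - e] gives [L e >= e]. *)
Lemma kelley_content (x : K) F : (forall A, F A -> open A) ->
  (0 < kelley_number R F)%E ->
  exists2 m, category_content m & exists2 e, 0 < e & forall A, F A -> e <= m A.
Proof.
move=> oF kF.
have K_nm : ~ meagre [set: K] by apply: K_baire; [exact: openT|exists x].
have [e e0 eF] : exists2 e : R, 0 < e & (e%:E <= kelley_number R F)%E.
  case: (kelley_number R F) kF => [r||]//; first by rewrite lte_fin => r0; exists r.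
  (* An infinite intersection number, as for the empty collection, allows [e = 1]. *)
  by move=> _; exists 1; rewrite ?leey.
pose C : set (K -> R) := [set c | exists2 s : seq (set K), (forall A, A \in s -> F A) &
  c = fun y => \sum_(A <- s) (\1_A y - e)].
have bcst a : bounded_by_const (cst a : K -> R) by exists `|a|.
have bind A : bounded_by_const (\1_A : K -> R).
  by exists 1 => y; rewrite indicE; case: (_ \in _); rewrite ?normr1 ?normr0.
have CD : C `<=` bounded_by_const.
  move=> _ [s _ ->]; elim: s => [|A s IH].
    by exists 0 => y; rewrite big_nil normr0.
  rewrite [X in bounded_by_const X](_ : _ =
    (\1_A - cst e) + (fun y => \sum_(A <- s) (\1_A y - e))); last first.
    by apply/funext => y; rewrite big_cons.
  apply: bounded_by_constD => //; apply: bounded_by_constD => //.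
  exact: bounded_by_constN.
have C0 : C 0 by exists [::] => //; apply/funext => y; rewrite big_nil.
have CC c d : C c -> C d -> C (c + d).
  move=> [s sF ->] [s' sF' ->]; exists (s ++ s').
    by move=> A; rewrite mem_cat => /orP[/sF|/sF'].
  by apply/funext => y; rewrite big_cat.
have Csup c : C c -> 0 <= category_sup c.
  by move=> [s sF ->]; exact: kelley_number_category_sup oF eF sF.
have [L [LD Lsup LC]] := additive_minorant_cone bounded_by_const0
  bounded_by_constD bounded_by_constN (category_sup_sublinear K_nm) CD C0 CC Csup.
have L0 : L 0 = 0.
  have := LD _ _ bounded_by_const0 bounded_by_const0; rewrite addr0 => /eqP.
  by rewrite -subr_eq0 opprD addNKr oppr_eq0 => /eqP.
have LN f : bounded_by_const f -> L (- f) = - L f.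
  move=> bf; apply/eqP; rewrite -addr_eq0 addrC -LD ?subrr ?L0//.
  exact: bounded_by_constN.
have Lle f t : bounded_by_const f -> category_bound f t -> L f <= t.
  by move=> bf ft; apply: le_trans (Lsup _ bf) _; exact: category_sup_le.
have L_ge0 A : 0 <= L \1_A.
  rewrite -oppr_le0 -LN//; apply: Lle; first exact: bounded_by_constN.
  by apply: category_bound_le => y; rewrite oppr_le0 indicE.
exists (fun A => L \1_A); first split=> //.
- apply: Lle => //; apply: category_bound_le => y; rewrite indicE.
  by case: (_ \in _).
- move=> A mA; apply/eqP; rewrite eq_le L_ge0 andbT; apply: Lle => //.
  apply: meagre_sub mA => y /=; rewrite indicE; case: (boolP (y \in A)).
    by rewrite inE.
  by rewrite ltxx.
- move=> A B AB; rewrite -LD//; congr L; apply/funext => y.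
  rewrite !fctE !indicE in_setU.
  have : ~~ ((y \in A) && (y \in B)).
    by rewrite -in_setI AB in_set0.
  by case: (y \in A); case: (y \in B); rewrite //= ?addr0 ?add0r.
exists e => // A FA.
have := LC (\1_A - cst e) _; rewrite LD//; last exact: bounded_by_constN.
rewrite LN// subr_ge0 => LA.
apply: (@le_trans _ _ (L (cst e))).
  rewrite -lerN2 -LN//; apply: Lle; first exact: bounded_by_constN.
  exact: category_bound_le.
apply: LA; exists [:: A]; first by move=> B; rewrite inE => /eqP ->.
by apply/funext => y; rewrite big_seq1.
Qed.

End FinitelyAdditive.

(** * From contents to category measures *)

Section CountableSums.
Context {R : realType} {K : topologicalType}.
Implicit Types (u : nat -> R) (A B : set K).

Lemma half_sum n : \sum_(0 <= i < n) 2^-1 ^+ i.+1 = 1 - 2^-1 ^+ n :> R.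
Proof.
elim: n => [|n IH]; first by rewrite big_nil expr0 subrr.
by rewrite big_nat_recr//= IH exprS; lra.
Qed.

Lemma half_sum_le1 n : \sum_(0 <= i < n) 2^-1 ^+ i.+1 <= 1 :> R.
Proof. by rewrite half_sum gerBl. Qed.

Lemma series_half_bound u n : (forall i, u i <= 2^-1 ^+ i.+1) -> series u n <= 1.
Proof.
by move=> u1; apply: le_trans (half_sum_le1 n); apply: ler_sum => i _; exact: u1.
Qed.

Lemma series_half_cvg u :
  (forall i, 0 <= u i) -> (forall i, u i <= 2^-1 ^+ i.+1) -> cvgn (series u).
Proof.
move=> u0 u1; apply: nondecreasing_is_cvgn.
  by apply: nondecreasing_series => n _ _; exact: u0.
by exists 1 => _ [n _ <-]; exact: series_half_bound.
Qed.

Lemma content_series (m : nat -> set K -> R) : (forall n, category_content (m n)) ->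
  exists2 c, category_content c & forall n A, 2^-1 ^+ n.+1 * m n A <= c A.
Proof.
move=> mP.
have m1 n A : m n A <= 1.
  have [m0 mT _ mD] := mP n; apply: le_trans mT.
  by rewrite -(setUv A) mD ?setICr// lerDl.
pose u A n := 2^-1 ^+ n.+1 * m n A.
have u0 A n : 0 <= u A n by have [m0 _ _ _] := mP n; rewrite mulr_ge0.
have u1 A n : u A n <= 2^-1 ^+ n.+1 by rewrite ler_piMr.
have ucvg A := series_half_cvg (u0 A) (u1 A).
have und A : nondecreasing_seq (series (u A)).
  by apply: nondecreasing_series => n _ _; exact: u0.
exists (fun A => limn (series (u A))) => [|n A]; last first.
  apply: le_trans (nondecreasing_cvgn_le (und A) (ucvg A) n.+1).
  by rewrite seriesSr lerDr; apply: sumr_ge0.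
split=> [A||A mA|A B AB].
- apply: le_trans (nondecreasing_cvgn_le (und A) (ucvg A) 0%N).
  by rewrite /series/= big_nil.
- by apply: limr_le => //; apply: nearW => n; exact: series_half_bound.
- rewrite (_ : series (u A) = cst 0) ?lim_cst//; apply/funext => n.
  by rewrite /series/= big1// => i _; have [_ _ m0 _] := mP i; rewrite /u m0// mulr0.
- rewrite -limD//; congr (limn _); rewrite -seriesD; congr series.
  by apply/funext => n; have [_ _ _ mD] := mP n; rewrite /u mD// mulrDr.
Qed.

End CountableSums.

(* [outer_part] is the countably additive part of [m] in the Yosida-Hewitt
   decomposition, [outer_part A] being the least limit of [m] along increasing
   sequences that exhaust [A]. *)
Section CountablyAdditivePart.
Context {R : realType} {K : topologicalType} {m : set K -> R}.
Hypothesis m_content : category_content m.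
Implicit Types (A : set K) (B : nat -> set K).

Definition baire_cover A B := [/\ forall k, baire_property (B k),
  forall k, B k `<=` B k.+1 & A `<=` \bigcup_k B k].

Definition outer_part A : R :=
  inf [set t | exists2 B, baire_cover A B & forall k, m (B k) <= t].

Lemma content_ge0 A : 0 <= m A. Proof. by case: m_content. Qed.

Lemma contentU A A' : A `&` A' = set0 -> m (A `|` A') = m A + m A'.
Proof. by case: m_content => _ _ _; apply. Qed.

Lemma content_le A A' : A `<=` A' -> m A <= m A'.
Proof.
move=> AA'; rewrite -(setDUK AA') contentU ?lerDl ?content_ge0//.
by rewrite setDE setICA setICr setI0.
Qed.

Lemma content_leU A A' : m (A `|` A') <= m A + m A'.
Proof.
have -> : A `|` A' = A `|` (A' `\` A).
  apply/seteqP; split=> x; last by move=> [|[]]; [left|right].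
  by move=> [Ax|A'x]; [left|have [Ax|nAx] := pselect (A x); [left|right]].
rewrite contentU ?lerD2l; first by apply: content_le => x [].
by rewrite setDE setICA setICr setI0.
Qed.

Lemma content_le_bigcup B n :
  m (\bigcup_(j in `I_n) B j) <= \sum_(0 <= j < n) m (B j).
Proof.
rewrite bigcup_mkord big_mkord; elim/big_ind2: _ => [|A s A' t As A't|i _] //.
  by have [_ _ -> //] := m_content; exact: meagre0.
by apply: le_trans (content_leU _ _) _; exact: lerD.
Qed.

Lemma baire_cover_le A B k l : baire_cover A B -> (k <= l)%N -> B k `<=` B l.
Proof.
move=> [_ BS _] /subnK <-; elim: (l - k)%N => [|n IH]; first exact: subset_refl.
by rewrite addSn; exact: subset_trans IH (BS _).
Qed.

Lemma outer_part_has_inf A :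
  has_inf [set t | exists2 B, baire_cover A B & forall k, m (B k) <= t].
Proof.
split; last by exists 0 => s [B _ /(_ 0%N)]; apply: le_trans; exact: content_ge0.
exists (m [set: K]), (fun=> [set: K]) => //.
split=> // [_|x _]; last by exists 0%N.
exact: open_baire_property openT.
Qed.

Lemma outer_part_le A B t : baire_cover A B -> (forall k, m (B k) <= t) ->
  outer_part A <= t.
Proof.
by move=> AB Bt; apply: ge_inf; [case: (outer_part_has_inf A)|exists B].
Qed.

Lemma lt_outer_part A B s : baire_cover A B -> s < outer_part A ->
  exists k, s < m (B k).
Proof.
move=> AB sA; apply: contrapT => nB; move: sA; apply/negP; rewrite -leNgt.
apply: (outer_part_le AB) => k; rewrite leNgt; apply/negP => sB.
by apply: nB; exists k.
Qed.

Lemma outer_part_ge A t :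
  (forall B s, baire_cover A B -> (forall k, m (B k) <= s) -> t <= s) ->
  t <= outer_part A.
Proof.
move=> tP; apply: lb_le_inf; last by move=> s [B AB Bs]; exact: tP AB Bs.
by have [[s [B AB Bs]] _] := outer_part_has_inf A; exists s, B.
Qed.

Lemma outer_part_ge0 A : 0 <= outer_part A.
Proof.
apply: outer_part_ge => B s _ /(_ 0%N); apply: le_trans; exact: content_ge0.
Qed.

Lemma outer_part_content A : baire_property A -> outer_part A <= m A.
Proof.
move=> bA; apply: (@outer_part_le _ (fun=> A)) => //.
by split=> [//|_|x Ax]; [exact: subset_refl|exists 0%N].
Qed.

Lemma outer_partS A A' : A `<=` A' -> outer_part A <= outer_part A'.
Proof.
move=> AA'; apply: outer_part_ge => B s [bB BS A'B] Bs.
by apply: outer_part_le Bs; split=> //; exact: subset_trans A'B.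
Qed.

(** A sequence covering the union, cut with [A] and with [A'], covers each of them, and one late
    index serves both. *)
Lemma outer_part_superadd A A' : baire_property A -> baire_property A' ->
  A `&` A' = set0 -> outer_part A + outer_part A' <= outer_part (A `|` A').
Proof.
move=> bA bA' AA'; apply: outer_part_ge => B s AB Bs; have [bB BS UB] := AB.
have cover X : baire_property X -> X `<=` A `|` A' ->
    baire_cover X (fun k => B k `&` X).
  move=> bX XA; split=> [k|k|x Xx]; first exact: baire_propertyI.
    exact: setSI.
  by have [k _ Bx] := UB x (XA x Xx); exists k.
rewrite leNgt; apply/negP => sAA'.
have [k kA] : exists k, s - outer_part A' < m (B k `&` A).
  apply: (lt_outer_part (cover _ bA (@subsetUl _ A A'))).
  by rewrite ltrBlDr.
have [l lA'] : exists l, s - m (B k `&` A) < m (B l `&` A').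
  apply: (lt_outer_part (cover _ bA' (@subsetUr _ A A'))).
  by rewrite ltrBlDr -ltrBlDl.
have : m (B k `&` A) + m (B l `&` A') <= s.
  apply: le_trans (Bs (maxn k l)); rewrite -contentU; last first.
    by rewrite setIACA AA' setI0.
  apply: content_le => x [[Bx _]|[Bx _]].
    by apply: (baire_cover_le AB) Bx; exact: leq_maxl.
  by apply: (baire_cover_le AB) Bx; exact: leq_maxr.
by move: lA'; move: (m _) (m _) => a b; lra.
Qed.

(** Near-optimal sequences [B j], with errors [e / 2 ^ (j + 1)], are merged along the diagonal:
    [C k] unites the sets [B j k] for [j <= k]. *)
Lemma outer_part_subadd (A : nat -> set K) s :
  (forall n, \sum_(0 <= i < n) outer_part (A i) <= s) ->
  outer_part (\bigcup_n A n) <= s.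
Proof.
move=> As; apply/ler_addgt0Pl => e e0.
have /choice[B BP] j : exists B, baire_cover (A j) B /\
    forall k, m (B k) <= outer_part (A j) + e * 2^-1 ^+ j.+1.
  have ej : 0 < e * 2^-1 ^+ j.+1 by rewrite mulr_gt0// exprn_gt0.
  have [t [C AC Ct] tA] := inf_adherent ej (outer_part_has_inf (A j)).
  by exists C; split=> // k; exact: le_trans (Ct k) (ltW tA).
pose C k := \bigcup_(j in `I_k.+1) B j k.
apply: (@outer_part_le _ C).
  split=> [k|k x [j /= jk Bx]|x [j _ Ax]].
  - rewrite /C bigcup_mkcond; apply: baire_property_bigcup => j.
    case: ifP => _; first by have [[bB _ _] _] := BP j.
    exact: baire_property0.
  - exists j; first exact: leq_trans jk _.
    by apply: (baire_cover_le (BP j).1) Bx; exact: leqnSn.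
  - have [[_ _ /(_ x Ax)[i _ Bx]] _] := BP j; exists (maxn i j) => //.
    exists j; first by rewrite /= ltnS leq_maxr.
    by apply: (baire_cover_le (BP j).1) Bx; exact: leq_maxl.
move=> k; apply: le_trans (_ : \sum_(0 <= j < k.+1) m (B j k) <= _).
  exact: (content_le_bigcup (fun j => B j k)).
apply: le_trans (_ : \sum_(0 <= j < k.+1) (outer_part (A j) + e * 2^-1 ^+ j.+1) <= _).
  by apply: ler_sum => j _; exact: (BP j).2.
rewrite big_split/= -mulr_sumr addrC lerD//.
by rewrite ler_piMr ?half_sum_le1// ltW.
Qed.

Lemma outer_part_sigma_additive (A : nat -> set K) :
  (forall n, baire_property (A n)) -> trivIset setT A ->
  (fun n => \sum_(0 <= i < n) outer_part (A i)) @ \oo --> outer_part (\bigcup_n A n).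
Proof.
move=> bA tA; set S := (fun n => _).
have bUA n : baire_property (\bigcup_(j in `I_n) A j).
  rewrite bigcup_mkcond; apply: baire_property_bigcup => j.
  by case: ifP => _; [exact: bA|exact: baire_property0].
have S_le n : S n <= outer_part (\bigcup_(j in `I_n) A j).
  rewrite /S; elim: n => [|n IH]; first by rewrite big_nil outer_part_ge0.
  rewrite big_nat_recr//= IIS bigcup_setU bigcup_set1.
  apply: le_trans (outer_part_superadd (bUA n) (bA n) _); first by rewrite lerD2r.
  apply/seteqP; split=> // x [[j /= jn Ajx] Anx].
  by move: jn; rewrite (tA j n) ?ltnn//; exists x.
have S_le_U n : S n <= outer_part (\bigcup_n A n).
  apply: le_trans (S_le n) _; apply: outer_partS => x [j _ Ax].
  by exists j.
have S_nd : nondecreasing_seq S.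
  by apply: nondecreasing_series => n _ _; exact: outer_part_ge0.
have S_cvg : cvgn S.
  apply: nondecreasing_is_cvgn => //.
  by exists (outer_part (\bigcup_n A n)) => _ [n _ <-].
suff -> : outer_part (\bigcup_n A n) = limn S by [].
apply/eqP; rewrite eq_le; apply/andP; split.
  by apply: outer_part_subadd => n; exact: nondecreasing_cvgn_le.
by apply: limr_le => //; exact: nearW.
Qed.

End CountablyAdditivePart.

(** * Strict positivity of the countably additive part modulo meagre sets *)

Section CategoryMeasure.
Context {R : realType} {K : topologicalType}.
Hypotheses (K_baire : forall U : set K, open U -> U !=set0 -> ~ meagre U).
Context {T : nat -> set (set K)} {m : set K -> R} {d : nat -> R}.
Hypotheses (m_content : category_content m) (d0 : forall n, 0 < d n)
  (dm : forall n A, T n A -> d n <= m A)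
  (T_open : \bigcup_n T n = [set U | open U /\ U !=set0])
  (T_bigcup : forall n (U : nat -> set K), (forall m, open (U m)) ->
    (forall m, U m `<=` U m.+1) -> T n (\bigcup_m U m) -> exists m0, T n (U m0))
  (T_meagre : forall n (U V : set K), T n U -> open V -> meagre (U `+` V) -> T n V).
Implicit Types (A U V : set K).

Lemma content_eq_meagre A V : meagre (A `+` V) -> m A <= m V.
Proof.
move=> AV; have [_ _ m0 _] := m_content.
apply: le_trans (_ : m (V `|` (A `+` V)) <= _).
  apply: content_le => // x Ax; have [Vx|nVx] := pselect (V x); first by left.
  by right; left.
by apply: le_trans (content_leU m_content _ _) _; rewrite (m0 _ AV) addr0.
Qed.

(** Modulo meagre sets the [B k] cut with [U] become increasing open sets exhausting [U]. Their
    union is in [T n] by (c), so one of them is by (b), and [m] ignores the meagre error. *)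
Lemma baire_cover_lower_bound n U B : T n U -> baire_cover U B ->
  exists k, d n <= m (B k).
Proof.
move=> TU [bB BS UB].
have oU : open U.
  have : (\bigcup_n T n) U by exists n.
  by rewrite T_open => -[].
pose B' k := B k `&` U.
have bB' k : baire_property (B' k).
  by apply: baire_propertyI => //; exact: open_baire_property.
have B'U : \bigcup_k B' k = U by rewrite /B' -setI_bigcupl setIidr.
have /choice[W WP] k : exists W, open W /\ meagre (B' k `+` W).
  by have /baire_propertyP[W] := bB' k; exists W.
have Ble j k : (j <= k)%N -> B' j `<=` B' k.
  move=> /subnK <-; elim: (k - j)%N => [|i IH]; first exact: subset_refl.
  by rewrite addSn; apply: subset_trans IH _; exact: setSI.
(* The [W k] are chosen independently and need not increase; their partial unions do, and still
   agree with [B' k] modulo a meagre set. *)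
pose V k := \bigcup_(j in `I_k.+1) W j.
have mBV k : meagre (B' k `+` V k).
  apply: (@meagre_sub _ _ (\bigcup_j (B' j `+` W j))).
    move=> x [[Bx nVx]|[[j /= jk Wx] nBx]].
      exists k => //; left; split=> // Wx; apply: nVx; exists k => //=.
    exists j => //; right; split=> // Bx; apply: nBx.
    by apply: Ble Bx; rewrite -ltnS.
  by apply: meagre_bigcup => j; exact: (WP j).2.
have oV k : open (V k) by apply: bigcup_open => j _; exact: (WP j).1.
have VS k : V k `<=` V k.+1.
  by move=> x [j /= jk Wx]; exists j => //=; exact: leq_trans jk _.
have UV : meagre (U `+` \bigcup_k V k).
  rewrite -B'U; apply: (@meagre_sub _ _ (\bigcup_k (B' k `+` V k))).
    move=> x [[[k _ Bx] nV]|[[k _ Vx] nB]]; exists k => //.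
      by left; split=> // Vx; apply: nV; exists k.
    by right; split=> // Bx; apply: nB; exists k.
  exact: meagre_bigcup.
have [k Tk] := T_bigcup oV VS (T_meagre TU (bigcup_open (fun k _ => oV k)) UV).
exists k; apply: le_trans (dm Tk) _.
apply: le_trans (content_eq_meagre (meagre_setYC (mBV k))) _.
by apply: content_le => // x [].
Qed.

Lemma outer_part_category_measure : category_measure (outer_part (m := m)).
Proof.
split=> [A _||A bA tA|A bA].
- exact: outer_part_ge0.
- apply/eqP; rewrite eq_le outer_part_ge0// andbT.
  have [_ _ m0 _] := m_content.
  by rewrite -(m0 _ meagre0); apply: outer_part_content => //; exact: baire_property0.
- exact: outer_part_sigma_additive.
- split=> [A0|mA]; last first.
    apply/eqP; rewrite eq_le outer_part_ge0// andbT.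
    have [_ _ m0 _] := m_content; rewrite -(m0 _ mA).
    exact: outer_part_content.
  have /baire_propertyP[U oU mAU] := bA.
  apply: contrapT => nmA.
  have U0 : U !=set0.
    apply/set0P/eqP => U0; apply: nmA; apply: meagre_sub mAU => x Ax.
    by left; split=> //; rewrite U0.
  have [n _ TU] : (\bigcup_n T n) U by rewrite T_open.
  (* A null [A] has a covering sequence with contents below [d n]. Adjoining the meagre set [A]+[U]
     makes it cover [U] at no cost, against the lower bound [d n] for members of [T n]. *)
  have [t [B [bB BS AB] Bt]] := inf_adherent (d0 n) (outer_part_has_inf m_content A).
  rewrite -/(outer_part A) A0 add0r => td.
  have [_ _ m0 _] := m_content.
  have UB : baire_cover U (fun k => B k `|` (A `+` U)).
    split=> [k|k|x Ux].
    - by apply: baire_propertyU => //; exact: meagre_baire_property.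
    - exact: setSU.
    - have [/AB[k _ Bx]|nAx] := pselect (A x); first by exists k => //; left.
      by exists 0%N => //; right; right.
  have [k dk] := baire_cover_lower_bound TU UB.
  have := le_trans dk (content_leU m_content _ _).
  by rewrite (m0 _ mAU) addr0 leNgt (le_lt_trans (Bt k) td).
Qed.

End CategoryMeasure.

Lemma property_star3_category_measure (R : realType) (K : topologicalType) :
  compact [set: K] -> hausdorff_space K -> property_star3 R K ->
  admits_category_measure K R.
Proof.
move=> K_compact K_hausdorff [T [T_open _ TP]].
have K_baire := open_not_meagre K_compact K_hausdorff.
(* The contents need a point of [K]. For empty [K] the only subset is meagre and the zero measure
   works. *)
have [[x _]|K0] := pselect ([set: K] !=set0); last first.
  have set_eq0 (A : set K) : A = set0.
    by apply/seteqP; split=> // x _; apply: K0; exists x.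
  exists (fun=> 0); split=> // [A _ _|A _].
    under eq_fun do rewrite big1//.
    exact: cvg_cst.
  by split=> // _; rewrite (set_eq0 A); exact: meagre0.
have /choice[c cP] n : exists m : set K -> R, category_content m /\
    exists e, 0 < e /\ forall A, T n A -> e <= m A.
  have [kT _ _] := TP n.
  have oT A : T n A -> open A.
    move=> TA; have : (\bigcup_n T n) A by exists n.
    by rewrite T_open => -[].
  have [m mc [e e0 eT]] := kelley_content K_baire x oT kT.
  by exists m; split=> //; exists e.
have [m m_content cm] := content_series (fun n => (cP n).1).
have /choice[e eP] n : exists e, 0 < e /\ forall A, T n A -> e <= c n A := (cP n).2.
have d0 n : 0 < 2^-1 ^+ n.+1 * e n :> R by rewrite mulr_gt0 ?exprn_gt0//; exact: (eP n).1.
have dm n A : T n A -> 2^-1 ^+ n.+1 * e n <= m A.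
  move=> TA; apply: le_trans (cm n A); rewrite ler_pM2l ?exprn_gt0//.
  exact: (eP n).2.
exists (outer_part (m := m)).
apply: (outer_part_category_measure (T := T) m_content d0 dm T_open).
- by move=> n; have [] := TP n.
- by move=> n; have [] := TP n.
Qed.

Theorem corollary5p4 (R : realType) (K : topologicalType)
    (K_compact : compact [set: K]) (K_hausdorff : hausdorff_space K) :
  [<-> property_star3 R K;
       admits_category_measure K R;
       admits_strictly_positive_sigma_order_continuous (continuousType K R);
       admits_strictly_positive_order_continuous (continuousType K R)]
  /\
  forall (E : banachLatticeType R)
    (J : {linear continuousType K R -> E}), is_dedekind_completion J ->
  [<-> property_star3 R K;
       admits_category_measure K R;
       admits_strictly_positive_sigma_order_continuous E;
       admits_strictly_positive_sigma_order_continuous (continuousType K R);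
       admits_strictly_positive_order_continuous (continuousType K R);
       admits_strictly_positive_order_continuous E].
Proof.
have star3_cat := @property_star3_category_measure R K K_compact K_hausdorff.
have cat_sigma := category_measure_functional K_compact K_hausdorff.
have sigma_oc (F : vectorLatticeType R) :
    admits_strictly_positive_sigma_order_continuous F ->
    admits_strictly_positive_order_continuous F.
  by move=> [phi [pos s]]; exists phi; split; [|exact: sigma_order_continuous_order].
have oc_sigma (F : vectorLatticeType R) :
    admits_strictly_positive_order_continuous F ->
    admits_strictly_positive_sigma_order_continuous F.
  by move=> [phi [pos o]]; exists phi; split; [|exact: order_continuous_sigma].
have oc_star3 :
    admits_strictly_positive_order_continuous (continuousType K R) ->
    property_star3 R K.
  move=> [phi [pos o]].
  exact: (property_star3_functional K_compact K_hausdorff pos o).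
split; first by tfae; [exact: star3_cat|exact: cat_sigma|exact: sigma_oc|].
move=> E J J_dc.
have restrict := order_continuous_restriction K_compact J_dc.
have extend : admits_strictly_positive_order_continuous (continuousType K R) ->
    admits_strictly_positive_order_continuous E.
  by move=> [phi [pos o]]; exact: (order_continuous_extension K_compact J_dc pos o).
tfae.
- exact: star3_cat.
(* No measure is integrated over [E]: the functional is built on C(K) and extended by order
   continuity. *)
- by move=> /cat_sigma/sigma_oc/extend/oc_sigma.
- by move=> /sigma_oc/restrict/oc_sigma.
- exact: sigma_oc.
- exact: extend.
- by move=> /restrict/oc_star3.
Qed.
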